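(* There is an NC algorithm (polylogarithmic parallel time with polynomially many processors) that, given a stable marriage instance and a stable matching $M$, outputs the stable matching $M\backslash\rho$ for each rotation $\rho$ exposed in $M$, or determines that $M$ is the woman-optimal stable matching.
   Context: A stable marriage instance has $n$ men and $n$ women, each with a strictly ordered preference list over all members of the opposite sex. A matching is a bijection between men and women; $p_M(x)$ is $x$'s partner in $M$. A pair $(m,w)$ not matched in $M$ is blocking if $m$ prefers $w$ to $p_M(m)$ and $w$ prefers $m$ to $p_M(w)$; $M$ is stable if it has no blocking pair. The woman-optimal stable matching is the stable matching that every woman weakly prefers to all other stable matchings. For $k\ge 2$, a rotation exposed in a stable matching $M$ is an ordered list $\rho=((m_0,w_0),\dots,(m_{k-1},w_{k-1}))$ of pairs in $M$ such that for each $i$, $w_{i+1}$ (indices mod $k$) is the highest ranked woman on $m_i$'s list such that $m_i$ prefers $w_i$ to $w_{i+1}$ and $w_{i+1}$ prefers $m_i$ to $m_{i+1}$. Eliminating $\rho$ gives $M\backslash\rho := (M\setminus\rho)\cup\{(m_0,w_1),(m_1,w_2),\dots,(m_{k-1},w_0)\}$, which is again stable. *)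

(* Defs.v *)
From mathcomp Require Import all_boot all_fingroup.

Set Implicit Arguments.
Unset Strict Implicit.
Unset Printing Implicit Defensive.

(** * Stable marriage *)

(* The men and the women are two copies of 'I_n.  A preference list is a
   bijection from positions to persons, position 0 being the favourite:
   [men_pref I m r] is the woman at position r of the list of man m. *)
Record instance (n : nat) := Instance {
  men_pref : 'I_n -> {perm 'I_n};
  women_pref : 'I_n -> {perm 'I_n}
}.

(* From men to women: the partner of man m is [M m], the partner of woman w
   is [(M^-1)%g w]. *)
Notation matching n := {perm 'I_n}.

Section StableMarriage.
Variables (n : nat) (I : instance n).
Implicit Types (M : matching n) (m w : 'I_n) (rho : seq ('I_n * 'I_n)).

Definition rank (L : {perm 'I_n}) (x : 'I_n) : nat := (L^-1)%g x.

Definition man_prefers m w1 w2 : bool :=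
  rank (men_pref I m) w1 < rank (men_pref I m) w2.
Definition woman_prefers w m1 m2 : bool :=
  rank (women_pref I w) m1 < rank (women_pref I w) m2.

Definition blocking M m w : bool :=
  [&& M m != w, man_prefers m w (M m) & woman_prefers w m ((M^-1)%g w)].

Definition stable M : Prop := forall m w, ~~ blocking M m w.

Definition woman_optimal M : Prop :=
  stable M /\
  forall M', stable M' ->
  forall w, ~~ woman_prefers w ((M'^-1)%g w) ((M^-1)%g w).

Definition next_candidate M m w : bool :=
  man_prefers m (M m) w && woman_prefers w m ((M^-1)%g w).

Definition is_next M m w : bool :=
  next_candidate M m w &&
  [forall w', next_candidate M m w' ==> ~~ man_prefers m w' w].

(* [path.cycle] relates each pair (m_i, w_i) to (m_(i+1), w_(i+1)), indices
   modulo the length of the list. *)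
Definition exposed M rho : Prop :=
  [/\ 2 <= size rho, uniq rho, all (fun p => M p.1 == p.2) rho
    & path.cycle (fun p q => is_next M p.1 q.2) rho].

Definition pairs_of M : {set 'I_n * 'I_n} := [set p | M p.1 == p.2].

(* (m_0, w_1), (m_1, w_2), ..., (m_(k-1), w_0) *)
Definition shifted rho : seq ('I_n * 'I_n) :=
  zip (unzip1 rho) (rot 1 (unzip2 rho)).

Definition eliminate M rho : {set 'I_n * 'I_n} :=
  (pairs_of M :\: [set p in rho]) :|: [set p in shifted rho].

End StableMarriage.

Inductive answer (n : nat) :=
  | WomanOptimal
  | Eliminations of seq (matching n).
Arguments WomanOptimal {n}.

Definition correct_answer n (I : instance n) (M : matching n)
    (a : answer n) : Prop :=
  match a with
  | WomanOptimal => woman_optimal I M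
  | Eliminations s =>
      [/\ s <> [::],
          forall rho, exposed I M rho ->
            exists2 M', M' \in s & pairs_of M' = eliminate M rho
        & forall M', M' \in s ->
            stable I M' /\
            exists2 rho, exposed I M rho & pairs_of M' = eliminate M rho]
  end.

(** * Encodings as lists of numbers *)

Definition encode_perm n (s : {perm 'I_n}) : seq nat :=
  [seq (s i : nat) | i <- enum 'I_n].

Definition encode_input n (I : instance n) (M : matching n) : seq nat :=
  n :: flatten [seq encode_perm (men_pref I m) | m <- enum 'I_n]
    ++ flatten [seq encode_perm (women_pref I w) | w <- enum 'I_n]
    ++ encode_perm M.

Definition encode_answer n (a : answer n) : seq nat :=
  match a with
  | WomanOptimal => [:: 0]
  | Eliminations s => 1 :: size s :: flatten [seq encode_perm M | M <- s]
  end.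

(** * CREW PRAM with words of logarithmic length *)

(* All processors run the same program synchronously; each has its own
   program counter and its own registers, and knows its own number.  A word
   has b bits: registers, memory cells and addresses range over
   0, ..., 2 ^ b - 1, and results are reduced modulo 2 ^ b. *)

Definition word (b x : nat) : nat := x %% 2 ^ b.

Inductive binop := Add | Sub | Mul | Div | Mod | Eq | Lt.

(* Sub is truncated at 0, and x %/ 0 = 0, x %% 0 = x as in MathComp. *)
Definition eval_binop (o : binop) (x y : nat) : nat :=
  match o with
  | Add => x + y
  | Sub => x - y
  | Mul => x * y
  | Div => x %/ y
  | Mod => x %% y
  | Eq => x == y
  | Lt => x < y
  end.

(* The arguments d, x, y, a are register numbers. *)
Inductive instr :=
  | Const (d v : nat)                    (* d := v *)
  | Pid (d : nat)                        (* d := processor number *)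
  | Binop (o : binop) (d x y : nat)      (* d := x o y *)
  | Read (d a : nat)                     (* d := memory[a] *)
  | Write (a x : nat)                    (* memory[a] := x *)
  | JumpZero (x l : nat).                (* if x = 0 go to instruction l *)

Definition program := seq instr.

Record proc := Proc { pc : nat; reg : nat -> nat }.

Record config (P : nat) := Config {
  shared : nat -> nat;
  procs : 'I_P -> proc
}.

Definition set_reg (s : proc) (d v : nat) : proc :=
  Proc (pc s).+1 (fun r => if r == d then v else reg s r).

(* A processor whose program counter is past the end of the program has
   halted. *)
Definition step_proc (b : nat) (prog : program) (memory : nat -> nat)
    (pid : nat) (s : proc) : proc :=
  match onth prog (pc s) with
  | None => s
  | Some (Const d v) => set_reg s d (word b v)
  | Some (Pid d) => set_reg s d (word b pid)
  | Some (Binop o d x y) =>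
      set_reg s d (word b (eval_binop o (reg s x) (reg s y)))
  | Some (Read d a) => set_reg s d (memory (reg s a))
  | Some (Write _ _) => Proc (pc s).+1 (reg s)
  | Some (JumpZero x l) =>
      Proc (if reg s x == 0 then l else (pc s).+1) (reg s)
  end.

Definition written_value (prog : program) (s : proc) : nat :=
  if onth prog (pc s) is Some (Write _ x) then reg s x else 0.

Definition write_address (prog : program) (s : proc) : option nat :=
  if onth prog (pc s) is Some (Write a _) then Some (reg s a) else None.

Definition exclusive_write P (prog : program) (c : config P) : bool :=
  [forall p, forall q,
    (p != q) && (write_address prog (procs c p) != None) ==>
    (write_address prog (procs c p) != write_address prog (procs c q))].

(* Within a step all reads precede all writes.  A concurrent write to one
   cell makes the computation fail. *)
Definition step (b : nat) (prog : program) P (c : config P) :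
    option (config P) :=
  if exclusive_write prog c then
    Some (Config
      (fun a => if [pick p | write_address prog (procs c p) == Some a]
                     is Some p
                then written_value prog (procs c p) else shared c a)
      (fun p => step_proc b prog (shared c) p (procs c p)))
  else None.

Definition init (b : nat) (x : seq nat) P : config P :=
  Config (fun a => word b (nth 0 x a)) (fun=> Proc 0 (fun=> 0)).

Definition halted (prog : program) P (c : config P) : Prop :=
  forall p, size prog <= pc (procs c p).

(* The length of the output is found in cell 0, the output itself in the
   cells that follow. *)
Definition output P (c : config P) : seq nat :=
  [seq shared c i.+1 | i <- iota 0 (shared c 0)].

(* With N the length of the input x, the program is run by N ^ k processors
   on words of k * (log N + 1) bits, and produces the output y in at most
   k * (log N + 1) ^ k steps.  The numbers of processors and of bits are
   fixed functions of N, so that they cannot carry nonuniform advice. *)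
Definition NC_computes (prog : program) (k : nat) (x y : seq nat) : Prop :=
  let N := size x in
  let lg := (trunc_log 2 N).+1 in
  exists (t : nat) (c : config (N ^ k)),
    [/\ t <= k * lg ^ k,
        iter t (obind (@step (k * lg) prog (N ^ k)))
          (Some (init (k * lg) x (N ^ k))) = Some c,
        halted prog c
      & output c = y].

(* Main.v *)
Require Import Defs.
From mathcomp Require Import all_boot all_fingroup zify.

Set Implicit Arguments.
Unset Strict Implicit.
Unset Printing Implicit Defensive.

(** Polylogarithmic time excludes scanning a list, so every scan becomes the iteration of a map of
    cells into themselves. Three coordinates are needed because each pair of a woman and a man gets
    its own search along her list; each coordinate has n + 1 values, the last of which means nobody
    or not found. This is the origin of the (n + 1)^3 active processors.

    Ranks are compared without inverting a list: a search that stops at either of two persons ends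
    at the one preferred.

    The cycles are neither counted nor listed without repetition. One matching is output for each
    man, and a man who runs into a fixed point borrows the cycle of a fixed other man. Repetitions
    are allowed in an answer, and the length of the output becomes a function of n alone.

    Programs are built from assignments executed in lockstep by all active processors. Their
    expressions have degree independent of n, so one simulation result covers word overflow,
    exclusive writes and running time, and the algorithm itself is verified on pure functions of
    memory. *)

(* Send a man m to the M-partner f m of the next woman w on his list who
   prefers him to her partner, and to m itself if there is none.  The exposed
   rotations are the cycles of f of length at least 2, and all of them are
   found by pointer jumping: O(log n) squarings of f carry every man to a fixed
   point or onto such a cycle, and squaring f stopped at a man m decides
   whether m is on a given cycle.  The next women and the ranks are found by
   pointer jumping as well, on the map r -> r + 1 of list positions stopped at
   the first hit.  If M is not woman-optimal, the men who prefer M to some other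
   stable matching that a woman prefers are mapped by f into themselves without
   fixed points, so some cycle exists. *)

(** * Compiling data-parallel assignments *)

(* [Me] is the number of the processor, [Len] the size n of the instance and
   [Vol] the number (n + 1)^3 of processors that stay active. *)
Inductive expr :=
  | Lit of nat
  | Me
  | Len
  | Vol
  | Op of binop & expr & expr
  | Get of expr.

Definition volume n := n.+1 ^ 3.

Fixpoint eval n (mem : nat -> nat) p e : nat :=
  match e with
  | Lit v => v
  | Me => p
  | Len => n
  | Vol => volume n
  | Op o e1 e2 => eval_binop o (eval n mem p e1) (eval n mem p e2)
  | Get e => mem (eval n mem p e)
  end.

(* Every intermediate value of [e] is at most X ^ deg e if X >= 2 bounds the
   memory, the processor numbers and [Vol]; hence no word ever overflows. *)
Fixpoint deg e :=
  match e with
  | Lit v => v.+1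
  | Op _ e1 e2 => (deg e1 + deg e2).+1
  | Get e => deg e
  | _ => 1
  end.

(** Register [d] is the top of an evaluation stack: the second operand of a binary operation is
    computed in [d.+1], which leaves the first one intact. *)
Fixpoint compile d e : program :=
  match e with
  | Lit v => [:: Const d v]
  | Me => [:: Pid d]
  | Len => [:: Const d 0; Binop Add d d 0]
  | Vol => [:: Const d 0; Binop Add d d 1]
  | Op o e1 e2 => compile d e1 ++ compile d.+1 e2 ++ [:: Binop o d d d.+1]
  | Get e => compile d e ++ [:: Read d d]
  end.

(* Memory is cut into blocks of length [Vol], block 0 holding the input.
   [Store j e] lets each active processor p put [e] into cell p of block j, so
   that writes are exclusive; [Iterate j e] repeats this until 2 to the number
   of rounds exceeds n. *)
Inductive stmt := Store of nat & expr | Iterate of nat & expr.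

Definition store_addr j := Op Add (Op Mul (Lit j) Vol) Me.
(* The reduction modulo [Vol] + 1 bounds the memory whatever [e] is. *)
Definition store_val e := Op Mod e (Op Add Vol (Lit 1)).

Definition store_code j e : program :=
  compile 3 (store_addr j) ++ compile 4 (store_val e) ++ [:: Write 3 4].

Definition stmt_code pos st : program :=
  match st with
  | Store j e => store_code j e
  | Iterate j e =>
      Const 2 1 :: store_code j e ++
      [:: Binop Add 2 2 2; Binop Lt 3 0 2; JumpZero 3 pos.+1]
  end.

Fixpoint body_code pos sts : program :=
  if sts is st :: sts' then
    stmt_code pos st ++ body_code (pos + size (stmt_code pos st)) sts'
  else [::].

(* Registers 0, 1, 2 hold n, [Vol] and the loop counter; processors with number
   at least [Vol] halt at once. *)
Definition machine sts : program :=
  let body := body_code 9 sts in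
  [:: Const 0 0; Read 0 0; Const 1 1; Binop Add 2 0 1; Binop Mul 1 2 2;
      Binop Mul 1 1 2; Pid 3; Binop Lt 3 3 1; JumpZero 3 (9 + size body)]
  ++ body.

Definition store n j (v : nat -> nat) (mem : nat -> nat) : nat -> nat :=
  fun a => if a %/ volume n == j then v (a %% volume n) else mem a.

Definition exec_store n j e (mem : nat -> nat) : nat -> nat :=
  store n j (fun p => eval n mem p e %% (volume n).+1) mem.

Definition exec n st mem : nat -> nat :=
  match st with
  | Store j e => exec_store n j e mem
  | Iterate j e => iter (trunc_log 2 n).+1 (exec_store n j e) mem
  end.

Definition exec_seq n sts mem : nat -> nat := foldl (fun m st => exec n st m) mem sts.

Definition stmt_expr st := match st with Store _ e | Iterate _ e => e end.
Definition stmt_block st := match st with Store j _ | Iterate j _ => j end.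
Definition stmt_deg st := deg (store_addr (stmt_block st)) + deg (store_val (stmt_expr st)).
(** A crude common bound on the degrees of all statements; what matters is that it does not depend
    on n. *)
Definition body_deg sts := \sum_(st <- sts) stmt_deg st.

Lemma volume_gt0 n : 0 < volume n.
Proof. by rewrite expn_gt0. Qed.

Lemma leq_volume n : n <= volume n.
Proof. by rewrite /volume !expnS; nia. Qed.

Lemma deg_gt0 e : 0 < deg e.
Proof. by elim: e. Qed.

Lemma onth_size T (s : seq T) i x : onth s i = Some x -> i < size s.
Proof. by move=> h; rewrite -onthTE h. Qed.

(** * Simulation of compiled code *)

Section Machine.
Arguments onth : simpl never.
Variables (b : nat) (prog : program) (n X k : nat).
Hypotheses (X_ge2 : 2 <= X) (XX : X ^ k <= 2 ^ b) (volX : volume n < X).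

Lemma eval_bound mem p e :
  (forall a, mem a <= X) -> p <= X -> eval n mem p e <= X ^ deg e.
Proof.
move=> memX pX; have XS m : 0 < m -> X <= X ^ m.
  by case: m => // m _; rewrite expnS leq_pmulr // expn_gt0; lia.
have pos m : 0 < X ^ m by rewrite expn_gt0; lia.
elim: e => [v||||o e1 IH1 e2 IH2|e IH] //=.
- by apply: ltnW; apply: (leq_trans (ltn_expl v X_ge2)); rewrite leq_exp2l.
- by apply: leq_trans (leq_volume n) _; apply: ltnW.
- by apply: ltnW.
- have h12 : X * (X ^ deg e1 * X ^ deg e2) = X ^ (deg e1 + deg e2).+1 by rewrite expnS expnD.
  rewrite -h12; have := pos (deg e1); have := pos (deg e2).
  move: IH1 IH2; set x := eval _ _ _ e1; set y := eval _ _ _ e2.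
  set A := X ^ _; set B := X ^ _ => xA yB B0 A0.
  have AC : A <= A * B by rewrite leq_pmulr.
  have BC : B <= A * B by rewrite leq_pmull.
  have xyC : x * y <= A * B by apply: leq_mul.
  have CX : 2 * (A * B) <= X * (A * B) by rewrite leq_mul2r X_ge2 orbT.
  have := leq_div x y; have := leq_mod x y => h1 h2.
  by case: o => /=; move: (x * y) (A * B) xyC AC BC CX h1 h2 => xy C; lia.
- by apply: leq_trans (memX _) _; apply: XS; apply: deg_gt0.
Qed.

Lemma word_small v : v < 2 ^ b -> word b v = v.
Proof. by move=> h; rewrite /word modn_small. Qed.

Lemma eval_lt mem p e :
  (forall a, mem a <= X) -> p <= X -> deg e < k -> eval n mem p e < 2 ^ b.
Proof.
move=> memX pX dk; apply: leq_ltn_trans (eval_bound e memX pX) _.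
by apply: leq_trans XX; rewrite ltn_exp2l.
Qed.

Section Solo.
Variables (mem : nat -> nat) (p : nat).

(* A run of [p] alone without writes: the memory it reads does not change. *)
Definition solo t s s' :=
  iter t (step_proc b prog mem p) s = s' /\
  forall u, u < t -> write_address prog (iter u (step_proc b prog mem p) s) = None.

Lemma solo_trans t1 t2 s1 s2 s3 : solo t1 s1 s2 -> solo t2 s2 s3 -> solo (t1 + t2) s1 s3.
Proof.
move=> [e1 h1] [e2 h2]; split; first by rewrite addnC iterD e1.
move=> u ut; case: (ltnP u t1) => [/h1 //|tu].
by rewrite -(subnK tu) iterD e1; apply: h2; lia.
Qed.

Lemma solo1 s : write_address prog s = None -> solo 1 s (step_proc b prog mem p s).
Proof. by move=> h; split=> // -[]. Qed.

Lemma solo_halted t s : size prog <= pc s -> solo t s s.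
Proof.
move=> h; have st : step_proc b prog mem p s = s by rewrite /step_proc onth_default.
have it u : iter u (step_proc b prog mem p) s = s by elim: u => //= u ->.
by split=> [|u _]; rewrite it // /write_address onth_default.
Qed.

Definition code_at pos (c : program) :=
  forall i x, onth c i = Some x -> onth prog (pos + i) = Some x.

Lemma code_at_cat pos c1 c2 :
  code_at pos (c1 ++ c2) -> code_at pos c1 /\ code_at (pos + size c1) c2.
Proof.
move=> h; split=> i x hi.
  by apply: h; rewrite onth_cat (onth_size hi).
by rewrite -addnA; apply: h; rewrite onth_cat ltnNge leq_addr /= addKn.
Qed.

Lemma code_at_cons pos i c :
  code_at pos (i :: c) -> onth prog pos = Some i /\ code_at pos.+1 c.
Proof.
move=> h; split; first by rewrite -[pos]addn0; apply: h.
by move=> j x hj; rewrite addSnnS; apply: h.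
Qed.

Lemma loadP d v i s pos :
  code_at pos [:: i] -> pc s = pos -> i = Const d v \/ (i = Pid d /\ v = p) ->
  v < 2 ^ b ->
  exists s', [/\ solo 1 s s', pc s' = pos + 1,
    reg s' d = v & forall r, r < d -> reg s' r = reg s r].
Proof.
move=> /code_at_cons [c1 _] pcs; rewrite -pcs in c1 * => load vb.
have st : step_proc b prog mem p s = set_reg s d v.
  by rewrite /step_proc c1; case: load => [->|[-> <-]]; rewrite word_small.
exists (set_reg s d v); split.
- rewrite -st; apply: solo1; rewrite /write_address c1.
  by case: load => [->|[-> _]].
- by rewrite addn1.
- by rewrite /= eqxx.
- by move=> r rd; rewrite /= ltn_eqF.
Qed.

Lemma copyP d r v s pos :
  code_at pos [:: Const d 0; Binop Add d d r] -> pc s = pos -> r < d ->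
  reg s r = v -> v < 2 ^ b ->
  exists s', [/\ solo 2 s s', pc s' = pos + 2,
    reg s' d = v & forall r', r' < d -> reg s' r' = reg s r'].
Proof.
move=> /code_at_cons [c1 /code_at_cons [c2 _]] pcs rd rv vb; rewrite -pcs in c1 c2.
have s1E : step_proc b prog mem p s = set_reg s d 0.
  by rewrite /step_proc c1 /word mod0n.
exists (step_proc b prog mem p (set_reg s d 0)); split.
- rewrite -s1E; apply: (@solo_trans 1 1 s (step_proc b prog mem p s)); apply: solo1.
    by rewrite /write_address c1.
  by rewrite s1E /write_address /= c2.
- by rewrite /step_proc /= c2 /= pcs addn2.
- by rewrite /step_proc /= c2 /= !eqxx (ltn_eqF rd) rv add0n word_small.
- by move=> r' rd'; rewrite /step_proc /= c2 /= ltn_eqF.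
Qed.

(** The running time depends on the expression alone, so all active processors finish at the same
    step. Keeping the registers below [d] protects both pending operands and the registers 0, 1,
    2. *)
Lemma compileP d e s pos :
  (forall a, mem a <= X) -> p <= X -> deg e < k ->
  code_at pos (compile d e) -> pc s = pos -> 2 < d ->
  reg s 0 = n -> reg s 1 = volume n ->
  exists s', [/\ solo (size (compile d e)) s s', pc s' = pos + size (compile d e),
    reg s' d = eval n mem p e & forall r, r < d -> reg s' r = reg s r].
Proof.
move=> memX pX; elim: e d s pos => [v||||o e1 IH1 e2 IH2|e IH] d s pos dk /= code pcs d2 r0 r1.
- by apply: (loadP code pcs); [left | exact: (eval_lt memX pX dk)].
- by apply: (loadP code pcs); [right | exact: (eval_lt memX pX dk)].
- by apply: (copyP code pcs) => //; [lia | exact: (eval_lt memX pX dk)].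
- by apply: (copyP code pcs) => //; [lia | exact: (eval_lt memX pX dk)].
- have hlt := eval_lt memX pX dk; rewrite /= in hlt dk.
  have [code1 /code_at_cat [code2 /code_at_cons [c3 _]]] := code_at_cat code.
  have [s1 [so1 pc1 v1 k1]] := IH1 d s pos ltac:(lia) code1 pcs d2 r0 r1.
  have [|||s2 [so2 pc2 v2 k2]] := IH2 d.+1 s1 _ ltac:(lia) code2 pc1; rewrite ?k1 //; try lia.
  rewrite -pc2 in c3.
  exists (step_proc b prog mem p s2); split.
  + rewrite !size_cat /=; apply: (solo_trans so1); apply: (solo_trans so2); apply: solo1.
    by rewrite /write_address c3.
  + by rewrite /step_proc c3 /= pc2 !size_cat /=; lia.
  + by rewrite /step_proc c3 /= eqxx k2 // v1 v2 word_small.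
  + move=> r rd; rewrite /step_proc c3 /= ifN ?neq_ltn ?rd // k2 ?k1 //; lia.
- rewrite /= in dk; have [code1 /code_at_cons [c2 _]] := code_at_cat code.
  have [s1 [so1 pc1 v1 k1]] := IH d s pos dk code1 pcs d2 r0 r1.
  rewrite -pc1 in c2.
  exists (step_proc b prog mem p s1); split.
  + rewrite size_cat /=; apply: (solo_trans so1); apply: solo1.
    by rewrite /write_address c2.
  + by rewrite /step_proc c2 /= pc1 !size_cat /=; lia.
  + by rewrite /step_proc c2 /= eqxx v1.
  + by move=> r rd; rewrite /step_proc c2 /= ifN ?neq_ltn ?rd // k1.
Qed.

End Solo.

(** * Synchronous execution by all processors *)

Section Parallel.
Variable P : nat.
Hypothesis volP : volume n <= P.
Implicit Types c : config P.

Definition reaches t c c' := iter t (obind (@step b prog P)) (Some c) = Some c'.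

Lemma reaches_trans t1 t2 c1 c2 c3 :
  reaches t1 c1 c2 -> reaches t2 c2 c3 -> reaches (t1 + t2) c1 c3.
Proof. by rewrite /reaches => e1 e2; rewrite addnC iterD e1. Qed.

Lemma step_proc_ext m1 m2 p s :
  m1 =1 m2 -> step_proc b prog m1 p s = step_proc b prog m2 p s.
Proof. by move=> e; rewrite /step_proc; case: onth => [[]|] // *; rewrite e. Qed.

Lemma step_solo mem c :
  shared c =1 mem -> (forall q : 'I_P, write_address prog (procs c q) = None) ->
  exists2 c', step b prog c = Some c' &
    shared c' =1 mem /\ forall q, procs c' q = step_proc b prog mem q (procs c q).
Proof.
move=> cm now; have exw : exclusive_write prog c.
  by apply/forallP => p; apply/forallP => q; rewrite now eqxx andbF.
rewrite /step exw; eexists; first by [].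
split=> [a|q] /=; last exact: step_proc_ext.
by case: pickP => [p|_]; rewrite ?now ?cm.
Qed.

(** While nobody writes, the memory is constant and processors cannot influence each other, so the
    joint run is the family of the solo runs. *)
Lemma run_solo mem c t (post : 'I_P -> proc -> Prop) :
  shared c =1 mem ->
  (forall q : 'I_P, exists2 s', solo mem q t (procs c q) s' & post q s') ->
  exists2 c', reaches t c c' &
    shared c' =1 mem /\ forall q, post q (procs c' q).
Proof.
elim: t c => [|t IH] c cm h.
  by exists c => //; split=> // q; have [s' [/= <- _]] := h q.
have now q : write_address prog (procs c q) = None.
  by have [s' [_ /(_ 0 isT)]] := h q.
have [c1 e1 [cm1 p1]] := step_solo cm now.
have [q|c' e' [cm' p']] := IH c1 cm1.
  have [s' [e hw] ps] := h q; exists s' => //; split.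
    by rewrite p1 -iterSr.
  by move=> u ut; rewrite p1 -iterSr; apply: hw.
by exists c' => //; apply: (@reaches_trans 1 t _ c1).
Qed.

Definition ready mem pos cnt c :=
  shared c =1 mem /\ forall q : 'I_P,
    if q < volume n then
      [/\ pc (procs c q) = pos, reg (procs c q) 0 = n,
          reg (procs c q) 1 = volume n & reg (procs c q) 2 = cnt]
    else size prog <= pc (procs c q).

Lemma run_ready mem c t pos cnt (post : 'I_P -> proc -> Prop) :
  ready mem pos cnt c ->
  (forall (q : 'I_P) s, q < volume n -> pc s = pos -> reg s 0 = n ->
    reg s 1 = volume n -> reg s 2 = cnt -> exists2 s', solo mem q t s s' & post q s') ->
  exists2 c', reaches t c c' &
    shared c' =1 mem /\ forall q : 'I_P,
      if q < volume n then post q (procs c' q) else size prog <= pc (procs c' q).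
Proof.
move=> [cm hq] h.
apply: (@run_solo mem c t (fun q s => if q < volume n then post q s else size prog <= pc s)) => // q.
have := hq q; case: ifP => [qv [*]|_ hlt]; first exact: h.
by exists (procs c q) => //; apply: solo_halted.
Qed.

(** Addresses differ because processor numbers do, which gives exclusiveness; [volume n <= P]
    provides a writer for every cell of block [j]. *)
Lemma store_step mem j (v : nat -> nat) pos cnt c :
  shared c =1 mem -> onth prog pos = Some (Write 3 4) ->
  (forall q : 'I_P, if q < volume n then
     [/\ pc (procs c q) = pos, reg (procs c q) 0 = n, reg (procs c q) 1 = volume n,
         reg (procs c q) 2 = cnt & reg (procs c q) 3 = j * volume n + q /\
         reg (procs c q) 4 = v q]
     else size prog <= pc (procs c q)) ->
  exists2 c', reaches 1 c c' & ready (store n j v mem) pos.+1 cnt c'.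
Proof.
move=> cm code h.
have wa q : write_address prog (procs c q) =
    if q < volume n then Some (j * volume n + q) else None.
  have := h q; case: ifP => _; last by move=> hl; rewrite /write_address onth_default.
  by case=> pcq _ _ _ [r3 _]; rewrite /write_address pcq code r3.
have exw : exclusive_write prog c.
  apply/forallP => p; apply/forallP => q; apply/implyP; rewrite !wa => /andP [pq].
  case: ifP => // _ _; case: ifP => // _.
  by apply: contraNneq pq => -[/addnI epq]; apply/eqP/val_inj.
rewrite /reaches /= /step exw; eexists; first by [].
split=> [a|q] /=.
  rewrite /store; case: pickP => [p|no].
    rewrite wa; case: ifP => // pv /eqP [<-].
    rewrite divnMDl ?volume_gt0 // divn_small // addn0 eqxx modnMDl modn_small //.
    by have := h p; rewrite pv /written_value => -[-> _ _ _ [_ <-]]; rewrite code.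
  case: eqP => [aj|_]; last exact: cm.
  have av : a %% volume n < volume n by rewrite ltn_mod volume_gt0.
  have := no (Ordinal (leq_trans av volP)); rewrite wa /= av.
  by rewrite -aj -divn_eq eqxx.
have := h q; case: ifP => _.
  by case=> pcq r0 r1 r2 _; rewrite /step_proc pcq code.
by move=> hl; rewrite /step_proc onth_default.
Qed.

Lemma store_codeP mem j e pos cnt c :
  (forall a, mem a <= X) -> deg (store_addr j) + deg (store_val e) < k ->
  code_at pos (store_code j e) -> ready mem pos cnt c ->
  exists2 c', reaches (size (store_code j e)) c c' &
    ready (exec_store n j e mem) (pos + size (store_code j e)) cnt c'.
Proof.
move=> memX dk code rc.
have [codea /code_at_cat [codev /code_at_cons [codew _]]] := code_at_cat code.
pose A := compile 3 (store_addr j); pose V := compile 4 (store_val e).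
have [|c1 e1 [cm1 p1]] := @run_ready mem c (size A + size V) pos cnt (fun q s =>
  [/\ pc s = pos + size A + size V, reg s 0 = n, reg s 1 = volume n, reg s 2 = cnt &
    reg s 3 = j * volume n + q /\ reg s 4 = eval n mem q e %% (volume n).+1]) rc.
  move=> q s qv pcs r0 r1 r2; have qX : q <= X by lia.
  have [||||s1 [so1 pc1 v1 k1]] := @compileP mem q 3 (store_addr j) s pos memX qX _ codea pcs;
    rewrite ?r0 ?r1 //; first by lia.
  have [||||s2 [so2 pc2 v2 k2]] := @compileP mem q 4 (store_val e) s1 _ memX qX _ codev pc1;
    rewrite ?k1 ?r0 ?r1 //; first by lia.
  exists s2; first exact: (solo_trans so1 so2).
  split; rewrite ?pc2 ?pc1 //; try by rewrite k2 // k1.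
  by rewrite (k2 3) // v1 v2 /= addn1.
have [c2 e2 r2] := @store_step mem j (fun p => eval n mem p e %% (volume n).+1) _ cnt c1 cm1 codew p1.
have szE : size (store_code j e) = size A + size V + 1 by rewrite /store_code !size_cat addnA.
exists c2; rewrite szE; first exact: (reaches_trans e1 e2).
by rewrite !addnA addn1.
Qed.

Lemma exec_store_bound j e mem :
  (forall a, mem a <= volume n) -> forall a, exec_store n j e mem a <= volume n.
Proof.
move=> h a; rewrite /exec_store /store; case: ifP => // _.
by rewrite -ltnS ltn_mod.
Qed.

Lemma exec_bound st mem :
  (forall a, mem a <= volume n) -> forall a, exec n st mem a <= volume n.
Proof.
move=> h; case: st => j e /=; first exact: exec_store_bound.
by apply: exec_store_bound; elim: (trunc_log 2 n) => //= i; apply: exec_store_bound.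
Qed.

(** The loop counter is the same in all active processors, so they take the same branch and stay in
    lockstep. *)
Lemma stmt_codeP mem st pos cnt c :
  (forall a, mem a <= volume n) -> 2 < k -> stmt_deg st < k ->
  code_at pos (stmt_code pos st) -> ready mem pos cnt c ->
  exists t c' cnt', [/\ t <= (trunc_log 2 n).+1 * size (stmt_code pos st), reaches t c c' &
    ready (exec n st mem) (pos + size (stmt_code pos st)) cnt' c'].
Proof.
move=> memK k2 dk; have memX a : mem a <= X by apply: leq_trans (memK a) (ltnW volX).
case: st dk => j e dk code rc.
  have [c' e' r'] := store_codeP memX dk code rc.
  by exists (size (store_code j e)), c', cnt; split=> //=; rewrite leq_pmull.
have [c0 /code_at_cat [codes /code_at_cons [c1 /code_at_cons [c2 /code_at_cons [c3 _]]]]] :=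
  code_at_cons code.
set S := size (store_code j e) in c1 c2 c3.
have lt2b v : v <= X * X -> v < 2 ^ b.
  move=> vX; apply: leq_ltn_trans vX _; apply: leq_trans XX.
  by rewrite -[X * X]/(X ^ 2) ltn_exp2l.
have w1 : word b 1 = 1 by apply/word_small/lt2b; nia.
set L := (trunc_log 2 n).+1.
have iterK i a : iter i (exec_store n j e) mem a <= volume n.
  by elim: i a => //= i IH; apply: exec_store_bound.
have iterX i a : iter i (exec_store n j e) mem a <= X.
  by apply: leq_trans (iterK _ _) (ltnW volX).
(* The counter never exceeds twice the maximum of 1 and n, so doubling it does not overflow. *)
have pow i : i < L -> 2 ^ i.+1 <= X * X.
  rewrite /L ltnS => iL; rewrite expnS leq_mul //.
  have : 2 ^ i <= maxn 1 n.
    case: (posnP n) iL => [->|n0 iL]; first by rewrite trunc_log0 leqn0 => /eqP ->.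
    rewrite leq_max; apply/orP; right; apply: leq_trans (trunc_logP (isT : 1 < 2) n0).
    by rewrite leq_exp2l.
  by have := leq_volume n; lia.
(* State at the head of the loop after i complete rounds, all of which ended with a jump back. *)
have loop i : i < L -> exists c', reaches (1 + i * (S + 3)) c c' /\
    ready (iter i (exec_store n j e) mem) pos.+1 (2 ^ i) c'.
  elim: i => [_|i IH iL].
    have [|c' e' r'] := @run_ready mem c 1 pos cnt (fun q s =>
      [/\ pc s = pos.+1, reg s 0 = n, reg s 1 = volume n & reg s 2 = 1]) rc.
      move=> q s qv pcs r0 r1 r2; eexists.
        by apply: solo1; rewrite /write_address pcs c0.
      by rewrite /step_proc pcs c0 /= pcs w1.
    by exists c'; rewrite mul0n addn0.
  have [c' [e' r']] := IH (ltnW iL).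
  have [c4 e4 r4] := store_codeP (iterX i) dk codes r'.
  rewrite -iterS -/S in r4.
  have [|c5 e5 r5] := @run_ready _ c4 3 _ _ (fun q s =>
      [/\ pc s = pos.+1, reg s 0 = n, reg s 1 = volume n & reg s 2 = 2 ^ i.+1]) r4.
    move=> q s qv pcs r0 r1 r2.
    have p2 : word b (2 ^ i + 2 ^ i) = 2 ^ i.+1.
      by rewrite addnn -mul2n -expnS; apply/word_small/lt2b/pow/ltnW.
    have nlt : (n < 2 ^ i.+1) = false.
      apply/negbTE; rewrite -leqNgt.
      have n0 : 0 < n by move: iL; rewrite /L; case: (posnP n) => // ->; rewrite trunc_log0.
      by apply: leq_trans (trunc_logP (isT : 1 < 2) n0); rewrite leq_exp2l.
    eexists; first apply: (@solo_trans _ _ 1 2); first by apply: solo1; rewrite /write_address pcs c1.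
      apply: (@solo_trans _ _ 1 1); first by apply: solo1; rewrite /write_address /step_proc pcs c1 /= pcs c2.
      apply: solo1; rewrite /write_address /step_proc pcs c1 /= pcs c2 /= pcs c3 //.
    rewrite /step_proc pcs c1 /= pcs c2 /= pcs c3 /= r0 r1 r2 p2 nlt /= /word mod0n //.
  exists c5; split=> //.
  have -> : 1 + i.+1 * (S + 3) = (1 + i * (S + 3)) + (S + 3) by lia.
  by apply: reaches_trans e' _; apply: reaches_trans e4 e5.
(* The last round is separate: its test succeeds and control falls through. *)
have [c' [e' r']] := loop L.-1 (ltnSn _).
have [c4 e4 r4] := store_codeP (iterX L.-1) dk codes r'.
rewrite -iterS -/S in r4.
have [|c5 e5 r5] := @run_ready _ c4 3 _ _ (fun q s =>
      [/\ pc s = pos.+1 + S + 3, reg s 0 = n, reg s 1 = volume n & reg s 2 = 2 ^ L]) r4.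
  move=> q s qv pcs r0 r1 r2.
  have p2 : word b (2 ^ L.-1 + 2 ^ L.-1) = 2 ^ L.
    by rewrite addnn -mul2n -expnS; apply/word_small/lt2b/pow.
  have nlt : (n < 2 ^ L) = true by rewrite trunc_log_ltn.
  eexists; first apply: (@solo_trans _ _ 1 2); first by apply: solo1; rewrite /write_address pcs c1.
    apply: (@solo_trans _ _ 1 1); first by apply: solo1; rewrite /write_address /step_proc pcs c1 /= pcs c2.
    apply: solo1; rewrite /write_address /step_proc pcs c1 /= pcs c2 /= pcs c3 //.
  by rewrite /step_proc pcs c1 /= pcs c2 /= pcs c3 /= r0 r1 r2 p2 nlt /= w1 addn3.
have szI : size (stmt_code pos (Iterate j e)) = S + 4.
  by rewrite -[LHS]/(size (store_code j e ++ _)).+1 size_cat -addnS.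
(* A round costs S + 3 steps while the code has size S + 4; the slack pays for the initialisation of
   the counter. *)
exists (1 + L.-1 * (S + 3) + (S + 3)), c5, (2 ^ L); split.
- by rewrite szI -/L -[L]/(L.-1.+1); move: L.-1 => l; nia.
- by apply: reaches_trans e' _; apply: reaches_trans e4 e5.
- by rewrite szI (_ : pos + (S + 4) = pos.+1 + S + 3) //; lia.
Qed.

Lemma body_codeP mem sts pos cnt c :
  (forall a, mem a <= volume n) -> 2 < k -> body_deg sts < k ->
  code_at pos (body_code pos sts) -> ready mem pos cnt c ->
  exists t c' cnt', [/\ t <= (trunc_log 2 n).+1 * size (body_code pos sts), reaches t c c' &
    ready (exec_seq n sts mem) (pos + size (body_code pos sts)) cnt' c'].
Proof.
elim: sts mem pos cnt c => [|st sts IH] mem pos cnt c memK k2 dk code rc /=.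
  by exists 0, c, cnt; rewrite addn0.
rewrite /body_deg big_cons in dk.
have [code1 code2] := code_at_cat code.
have [|t1 [c1 [cnt1 [t1b e1 r1]]]] := stmt_codeP memK k2 _ code1 rc; first by lia.
have [|t2 [c2 [cnt2 [t2b e2 r2]]]] := IH _ _ _ _ (exec_bound st memK) k2 _ code2 r1.
  by rewrite /body_deg; lia.
exists (t1 + t2), c2, cnt2; rewrite size_cat mulnDr leq_add // addnA; split=> //.
exact: reaches_trans e1 e2.
Qed.

End Parallel.
End Machine.

(** The bound on the entries of [x] makes the initial reduction to words harmless. The final memory,
    being a function, is described pointwise. *)
Lemma machine_computes sts n k x :
  let N := size x in
  nth 0 x 0 = n -> all (fun v => v <= n) x -> volume n <= N ^ 2 -> 0 < N ->
  7 + (body_deg sts).*2 <= k -> size (machine sts) <= k ->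
  exists2 mem : nat -> nat, mem =1 exec_seq n sts (nth 0 x) &
    NC_computes (machine sts) k x [seq mem i.+1 | i <- iota 0 (mem 0)].
Proof.
move=> N x0 xn vN N0 dk sk.
set prog := machine sts; set lg := (trunc_log 2 N).+1; set b := k * lg.
have Nlg : N < 2 ^ lg by apply: trunc_log_ltn.
(* As N < 2 ^ lg, X exceeds N ^ 2 and hence [volume n]. Words of k * lg bits hold X to the power
   k/2, so degrees count twice in the bound on k; the 7 leaves k/2 at least 3 above the total
   degree. *)
pose X := 2 ^ (2 * lg).
have XE : X = 2 ^ lg * 2 ^ lg by rewrite /X mul2n -addnn expnD.
have X2 : 4 <= X by rewrite /X -[4]/(2 ^ 2) leq_exp2l // leq_pmulr.
have XX : X ^ k./2 <= 2 ^ b by rewrite /X -expnM leq_exp2l // /b; lia.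
have volX : volume n < X by rewrite XE; move: vN; rewrite expnS expn1; nia.
have P_lt : N ^ k <= 2 ^ b.
  by rewrite /b mulnC expnM leq_exp2r ?(ltnW Nlg) //; lia.
have volP : volume n <= N ^ k.
  by apply: leq_trans vN _; apply: leq_pexp2l => //; lia.
have vol0 := volume_gt0 n; have nvol := leq_volume n.
have Xb v : v <= X -> v < 2 ^ b.
  move=> vX; apply: leq_trans (leq_ltn_trans vX _) XX.
  by rewrite -{1}[X]expn1 ltn_exp2l; lia.
pose mem0 := nth 0 x; pose mem a := word b (mem0 a).
have memn a : mem0 a <= n.
  rewrite /mem0; case: (ltnP a (size x)) => [ax|ax]; last by rewrite nth_default.
  by move/allP: xn; apply; apply: mem_nth.
have memE : mem =1 mem0.
  by move=> a; rewrite /mem word_small //; apply: Xb; have := memn a; lia.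
pose c0 := init b x (N ^ k).
pose END := 9 + size (body_code 9 sts).
have szE : size prog = END by [].
have [] := @run_solo b prog _ mem0 c0 9 (fun q s =>
  if q < volume n then [/\ pc s = 9, reg s 0 = n, reg s 1 = volume n & reg s 2 = n.+1]
  else size prog <= pc s); first by [].
  move=> q; eexists.
    split; first by [].
    by do 9 ?[case=> [//|]].
  have wq : word b q = q by apply: word_small; apply: leq_trans (ltn_ord q) P_lt.
  have w0 : word b 0 = 0 by rewrite /word mod0n.
  have w1 : word b 1 = 1 by apply/word_small/Xb; lia.
  have wn : word b (n + 1) = n.+1 by rewrite addn1; apply/word_small/Xb; move: nvol volX; lia.
  have v2 : n.+1 * n.+1 <= volume n by rewrite /volume -[n.+1 * n.+1]/(n.+1 ^ 2) leq_pexp2l.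
  have wnn : word b (n.+1 * n.+1) = n.+1 * n.+1 by apply/word_small/Xb; lia.
  have wv : word b (n.+1 * n.+1 * n.+1) = volume n.
    by rewrite /volume !expnS expn0 muln1 -mulnA; apply/word_small/Xb; move: volX; rewrite /volume !expnS expn0 muln1; lia.
  rewrite /step_proc /=  w0 w1 /mem0 x0 wn wnn wv wq.
  by case: ltnP => hq /=; rewrite ?w1 ?w0 /= ?szE.
move=> c1 e1 [cm1 p1].
have rc1 : ready prog n mem0 9 n.+1 c1 by [].
have codeb : code_at prog 9 (body_code 9 sts).
  by move=> i y; rewrite /prog /machine; apply.
have memK a : mem0 a <= volume n by apply: leq_trans (memn a) nvol.
have [||t [c2 [cnt [tb e2 [cm2 p2]]]]] :=
  body_codeP (ltnW (ltnW X2)) XX volX volP memK _ _ codeb rc1; try by lia.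
exists (shared c2) => //.
exists (9 + t), c2; split.
- have nN : n <= N by rewrite -x0; case: (ltnP 0 N) => // _; move: vN; rewrite /volume; nia.
  have lgb : (trunc_log 2 n).+1 <= lg by rewrite ltnS leq_trunc_log.
  have : 9 + t <= lg * k.
    have : lg * size prog <= lg * k by rewrite leq_mul2l sk orbT.
    rewrite szE /END mulnDr => h; apply: leq_trans h; rewrite leq_add //.
    by apply: leq_trans tb _; rewrite leq_mul2r lgb orbT.
  move=> h; apply: leq_trans h _; rewrite mulnC leq_mul2l; apply/orP; right.
  by rewrite -{1}[lg]expn1; apply: leq_pexp2l => //; lia.
- exact: reaches_trans e1 e2.
- move=> q; have := p2 q; case: ifP => // _ [-> _ _ _]; by rewrite szE.
- by [].
Qed.

(** * Rotations *)

Local Notation orbit := fingraph.orbit.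
Local Notation order := fingraph.order.

Section Rotations.
Variables (n : nat) (I : instance n) (M : matching n).
Hypothesis stM : stable I M.
Implicit Types (m w h : 'I_n) (rho : seq ('I_n * 'I_n)).

Definition improves m w := woman_prefers I w m ((M^-1)%g w).

Lemma rank_inj (L : {perm 'I_n}) : injective (rank L).
Proof. by move=> x y /val_inj /perm_inj. Qed.

(* A woman who prefers [m] to her partner comes after [M m] on his list, as the
   pair would block [M] otherwise. *)
Lemma next_candidateE m w : next_candidate I M m w = improves m w.
Proof.
rewrite /next_candidate andb_idl // => imp; have := stM m w; apply: contraR => nman.
have ne : M m != w.
  by apply: contraTneq imp => <-; rewrite /improves permK /woman_prefers ltnn.
rewrite /blocking ne imp andbT /=.
move: nman; rewrite /man_prefers -leqNgt leq_eqVlt.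
by case/predU1P => [/rank_inj /esym e|//]; rewrite e eqxx in ne.
Qed.

Lemma is_next_unique m w w' : is_next I M m w -> is_next I M m w' -> w = w'.
Proof.
case/andP=> c /forallP b /andP [c' /forallP b'].
have := b w'; have := b' w; rewrite c c' /= /man_prefers -!leqNgt => h1 h2.
by apply: (@rank_inj (men_pref I m)); apply/eqP; rewrite eqn_leq h1 h2.
Qed.

Lemma is_next_neq m w : is_next I M m w -> (M^-1)%g w != m.
Proof.
case/andP=> /andP [_ wp] _; apply: contraTneq wp => ->.
by rewrite /woman_prefers ltnn.
Qed.

Lemma improves_next m w : improves m w -> exists w', is_next I M m w' /\
  (w' = w \/ man_prefers I m w' w).
Proof.
move=> imp; case: (arg_minnP (rank (men_pref I m)) imp) => w' imp' min.
exists w'; split.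
  rewrite /is_next next_candidateE imp'; apply/forallP => v; apply/implyP.
  by rewrite next_candidateE /man_prefers -leqNgt; apply: min.
by have := min _ imp; rewrite leq_eqVlt => /predU1P [/rank_inj|]; [left|right].
Qed.

Definition next_woman m := [pick w | is_next I M m w].
Definition next_man m := if next_woman m is Some w then (M^-1)%g w else m.
Local Notation f := next_man.

Lemma next_womanP m w : next_woman m = Some w <-> is_next I M m w.
Proof.
rewrite /next_woman; case: pickP => [v nv|none]; last by rewrite none.
by split=> [[<-]//|nw]; rewrite (is_next_unique nv nw).
Qed.

Lemma next_man_fixed m : (f m == m) = ~~ next_woman m.
Proof.
rewrite /f; case e: (next_woman m) => [w|]; last by rewrite eqxx.
by apply: negbTE; apply: is_next_neq; apply/next_womanP.
Qed.

Lemma next_man_next m : next_woman m -> is_next I M m (M (f m)).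
Proof.
rewrite /f; case e: (next_woman m) => [w|//] _.
by rewrite permKV; apply/next_womanP.
Qed.

(** No woman is worse off in [M'] than in [M], so a pair blocking [M'] would consist of a man and a
    woman who improves on her [M]-partner with him; his next woman is the first such, and his
    [M]-partner precedes all of them. *)
Lemma stable_shift (M' : matching n) :
  (forall m, M' m = M m \/ is_next I M m (M' m)) -> stable I M'.
Proof.
move=> step m w; apply/negP => /and3P [ne mp wp].
have imp : improves m w.
  have := step ((M'^-1)%g w); rewrite permKV /improves.
  case=> [e|/andP [/andP [_ wp'] _]]; first by rewrite {2}e permK.
  exact: ltn_trans wp wp'.
have [e|/andP [_ /forallP /(_ w)]] := step m.
  have := stM m w; rewrite /blocking; move: imp ne mp; rewrite /improves e.
  by move=> -> -> ->.
by rewrite next_candidateE imp mp.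
Qed.

(* [A] is the set of men who prefer [M] to [M'].  By stability [M] maps [A] into
   the women who prefer [M'], and [M'] maps the other movers into the women who
   prefer [M]; counting turns both inclusions into equalities. *)
Lemma suboptimal_next (M' : matching n) w0 :
  stable I M' -> woman_prefers I w0 ((M'^-1)%g w0) ((M^-1)%g w0) ->
  exists2 A : {set 'I_n}, A != set0 & forall m, m \in A -> next_woman m /\ f m \in A.
Proof.
move=> stM' w0p.
pose A := [set m | man_prefers I m (M m) (M' m)].
pose B := [set m | man_prefers I m (M' m) (M m)].
pose U := [set w | woman_prefers I w ((M'^-1)%g w) ((M^-1)%g w)].
pose V := [set w | woman_prefers I w ((M^-1)%g w) ((M'^-1)%g w)].
have MA : M @: A \subset U.
  apply/subsetP => _ /imsetP [m + ->]; rewrite !inE permK => mp.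
  have ne : M' m != M m by apply: contraTneq mp => ->; rewrite /man_prefers ltnn.
  have := stM' m (M m); rewrite /blocking ne mp /= /woman_prefers -leqNgt leq_eqVlt.
  by case/predU1P => [/rank_inj /(canRL (permKV _)) /esym|//] => e; rewrite e eqxx in ne.
have M'B : M' @: B \subset V.
  apply/subsetP => _ /imsetP [m + ->]; rewrite !inE permK => mp.
  have ne : M m != M' m by apply: contraTneq mp => ->; rewrite /man_prefers ltnn.
  have := stM m (M' m); rewrite /blocking ne mp /= /woman_prefers -leqNgt leq_eqVlt.
  by case/predU1P => [/rank_inj /(canRL (permKV _)) /esym|//] => e; rewrite e eqxx in ne.
have cAU : #|A| <= #|U| by rewrite -(card_imset (mem A) (@perm_inj _ M)) subset_leq_card.
have cBV : #|B| <= #|V| by rewrite -(card_imset (mem B) (@perm_inj _ M')) subset_leq_card.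
have AB : A :|: B = [set m | M m != M' m].
  apply/setP => m; rewrite !inE /man_prefers -neq_ltn; congr negb.
  by apply/eqP/eqP => [/rank_inj|->].
have UV : U :|: V = [set w | (M^-1)%g w != (M'^-1)%g w].
  apply/setP => w; rewrite !inE /woman_prefers -neq_ltn eq_sym; congr negb.
  by apply/eqP/eqP => [/rank_inj|->].
have dAB : [disjoint A & B].
  by rewrite -setI_eq0; apply/eqP/setP => m; rewrite !inE /man_prefers; case: ltngtP.
have dUV : [disjoint U & V].
  by rewrite -setI_eq0; apply/eqP/setP => m; rewrite !inE /woman_prefers; case: ltngtP.
(* The women whose partner changes are the [M]-images of the men whose partner changes. *)
have cABUV : #|A :|: B| = #|U :|: V|.
  rewrite AB UV -(card_imset (mem [set m | _]) (@perm_inj _ M)); apply: eq_card => w.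
  apply/imsetP/idP => [[m + ->]|wh].
    by rewrite !inE permK; apply: contraNneq => {2}->; rewrite permKV.
  exists ((M^-1)%g w); rewrite ?permKV //; move: wh; rewrite !inE permKV.
  by apply: contraNneq => {2}->; rewrite permK.
have MAU : M @: A = U.
  apply/eqP; rewrite eqEcard MA /= card_imset; last exact: perm_inj.
  move: cABUV; rewrite !cardsU !disjoint_setI0 // cards0 !subn0; move: #|A| #|B| #|U| #|V| cAU cBV; lia.
have M'BV : M' @: B = V.
  apply/eqP; rewrite eqEcard M'B /= card_imset; last exact: perm_inj.
  move: cABUV; rewrite !cardsU !disjoint_setI0 // cards0 !subn0; move: #|A| #|B| #|U| #|V| cAU cBV; lia.
exists A.
  by apply: contraTneq w0p => A0; have := in_set0 w0; rewrite -(imset0 M) -A0 MAU inE => ->.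
(* The partner of this woman changes, and she is not in V, the [M']-image of B, as m is not in B. *)
move=> m mA; have mU : M' m \in U.
  have : M' m \in U :|: V.
    rewrite UV inE permK; have : m \in A :|: B by rewrite inE mA.
    by rewrite AB inE; apply: contraNneq => e; rewrite -{1}e permKV.
  rewrite inE => /orP [//|]; rewrite -M'BV (mem_imset _ _ (@perm_inj _ M')) => mB.
  by have := disjointFr dAB mA; rewrite mB.
have imp : improves m (M' m) by move: mU; rewrite inE permK.
have [w [nw wpref]] := improves_next imp.
rewrite /f (iffRL (next_womanP m w) nw); split=> //.
(* If w precedes [M' m] on the list of m, stability of [M'] makes her like her [M']-partner at least
   as much as m, whom she prefers to her [M]-partner. *)
suff : w \in U by rewrite -MAU => /imsetP [m' m'A ->]; rewrite permK.
case: wpref => [->//|mp]; rewrite inE.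
have wne : M' m != w by apply: contraTneq mp => ->; rewrite /man_prefers ltnn.
have := stM' m w; rewrite /blocking wne mp /= /woman_prefers -leqNgt => h.
by apply: leq_ltn_trans h _; case/andP: nw; rewrite next_candidateE.
Qed.

(** A nonempty set of men that [f] maps into itself, all having a next woman, would contain the t-th
    iterate of each of its members. *)
Lemma woman_optimal_if t : (forall m, ~~ next_woman (iter t f m)) -> woman_optimal I M.
Proof.
move=> none; split=> // M' stM' w; apply/negP => wp.
have [A /set0Pn [m mA] clA] := suboptimal_next stM' wp.
have : iter t f m \in A by elim: t {none} => //= t /clA [].
by case/clA; rewrite (negbTE (none m)).
Qed.

(** * Rotations as cycles of [next_man] *)

Lemma shifted_next rho :
  path.cycle (fun p q => is_next I M p.1 q.2) rho ->
  all (fun p => is_next I M p.1 p.2) (shifted rho).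
Proof.
case: rho => [//|q rho]; rewrite /shifted /= rot1_cons.
(* The pair that starts the path varies with the induction; the same pair in its role of closing the
   cycle stays fixed. *)
elim: rho {1 3}q => [|q' rho IH] q1 /=; first by rewrite /= andbT.
by case/andP=> -> /IH.
Qed.

Lemma unzip1_shifted rho : unzip1 (shifted rho) = unzip1 rho.
Proof. by rewrite unzip1_zip // size_rot !size_map. Qed.

(** Elimination acts man by man: [rho] contains all pairs of [M] on its men, and uniqueness of the
    next woman does the same for the shifted pairs. *)
Lemma in_eliminate rho m w : exposed I M rho ->
  ((m, w) \in eliminate M rho) = if m \in unzip1 rho then is_next I M m w else M m == w.
Proof.
case=> _ _ /allP inM /shifted_next /allP nxt.
have rhoE : ((m, w) \in rho) = (m \in unzip1 rho) && (M m == w).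
  apply/idP/andP => [mw|[/mapP [[m' w'] mw /= ->] /eqP <-]].
    by split; [exact: (map_f (@fst _ _) mw) | exact: inM mw].
  by rewrite (eqP (inM _ mw)).
have shE : ((m, w) \in shifted rho) = (m \in unzip1 rho) && is_next I M m w.
  rewrite -unzip1_shifted; apply/idP/andP => [mw|[/mapP [[m' w'] mw /= e] nw]].
    by split; [exact: (map_f (@fst _ _) mw) | exact: nxt mw].
  by rewrite (is_next_unique nw (_ : is_next I M m w')) ?e //; apply: nxt mw.
rewrite !inE rhoE shE /=; case: (m \in unzip1 rho) => /=; last by rewrite orbF.
by rewrite andNb.
Qed.

(** The next woman of a man on [rho] is the [M]-partner of the following man, so [f] sends each man
    to his successor. *)
Lemma exposed_fcycle rho : exposed I M rho ->
  fcycle f (unzip1 rho) /\ forall m, m \in unzip1 rho -> next_woman m.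
Proof.
case=> _ _ /allP inM cyc; split.
  rewrite /unzip1 cycle_map; apply: (@sub_in_cycle _ (mem rho)) cyc; last exact/allP.
  move=> p q /inM pM /inM /eqP qM nx /=; rewrite /f (iffRL (next_womanP _ _) nx).
  by rewrite -qM permK.
move=> m; rewrite -unzip1_shifted => /mapP [p /(allP (shifted_next cyc)) nx ->].
by rewrite (iffRL (next_womanP _ _) nx).
Qed.

Lemma iter_cyclic t m : n <= t -> fcycle f (orbit f (iter t f m)).
Proof.
move=> nt; apply/(orbitPcycle 3 0).
(* The iterate of index [order f m], at most n, repeats an earlier one of index i; from there on the
   sequence has period [order f m - i]. *)
have := looping_order f m; rewrite /looping => /trajectP [i io e].
have ot : order f m <= t.
  by apply: leq_trans nt; rewrite -[X in _ <= X]card_ord max_card.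
exists (order f m - i).-1; rewrite prednK ?subn_gt0 // -iterD.
have -> : order f m - i + t = t - i + order f m by lia.
by rewrite iterD e -iterD subnK // (leq_trans (ltnW io)).
Qed.

(** A man without next woman is a fixed point of [f], and a cycle through a fixed point is that
    point alone. *)
Lemma cyclic_next h : fcycle f (orbit f h) -> next_woman h ->
  forall m, m \in orbit f h -> next_woman m.
Proof.
move=> cyc nh m mh; apply: contraLR (nh); rewrite -!next_man_fixed => /eqP fm.
have hm : h \in orbit f m by rewrite (in_orbit_cycle cyc mh) ?in_orbit.
have fix_ i : iter i f m = m by elim: i => //= i ->.
move: hm; rewrite -fconnect_orbit => /iter_findex; rewrite fix_ => <-.
by rewrite fm.
Qed.

(** The stopped walk agrees with that of [f] until it meets m and then stays there; a reachable m is
    met in fewer than n steps. *)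
Lemma in_orbit_stop t h m : n <= t ->
  (iter t (fun x => if x == m then x else f x) h == m) = (m \in orbit f h).
Proof.
move=> nt; set s := fun x => _; apply/eqP/idP => [e|].
  rewrite -[X in X \in _]e; elim: t {nt e} => [|t IH] /=; first exact: in_orbit.
  by rewrite {1}/s; case: ifP => // _; apply: fingraph.mem_orbit.
rewrite -fconnect_orbit => hm; pose j := findex f h m.
have jt : j <= t.
  apply: leq_trans (ltnW (findex_max hm)) _.
  by apply: leq_trans nt; rewrite -[X in _ <= X]card_ord max_card.
have alt i : iter i s h = m \/ iter i s h = iter i f h.
  elim: i => [|i /= IH]; first by right.
  by rewrite {1 3}/s; case: eqP => [|ne]; [left|right; case: IH => // ->].
have jm : iter j s h = m by have [//|->] := alt j; apply: iter_findex.
rewrite -(subnK jt) iterD jm; elim: (t - j) => //= i ->.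
by rewrite /s eqxx.
Qed.

(** [f] is injective on the cycle, and it keeps men of the cycle on it, so their new partners differ
    from those of the other men. *)
Lemma rotation_perm h : fcycle f (orbit f h) ->
  exists p : matching n, forall m, p m = if m \in orbit f h then M (f m) else M m.
Proof.
move=> cyc; pose g m := if m \in orbit f h then M (f m) else M m.
suff gi : injective g by exists (perm gi) => m; rewrite permE.
have inj := iffLR (orbitPcycle 0 5) cyc.
move=> x y; rewrite /g; case: ifPn => xo; case: ifPn => yo /perm_inj //.
- exact: inj.
- by move=> e; rewrite -e fingraph.mem_orbit in yo.
- by move=> e; rewrite e fingraph.mem_orbit in xo.
Qed.

Lemma rotation_exposed h : fcycle f (orbit f h) -> next_woman h ->
  exposed I M [seq (m, M m) | m <- orbit f h].
Proof.
move=> cyc nh; have nx := cyclic_next cyc nh; split.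
- rewrite size_map size_orbit ltnNge; apply/negP => o1.
  have fh : f h \in orbit f h by rewrite fingraph.mem_orbit ?in_orbit.
  have := next_man_fixed h; rewrite nh => /negP; apply.
  have : #|[set h; f h]| <= order f h.
    rewrite -size_orbit -(card_uniqP (orbit_uniq f h)); apply/subset_leq_card/subsetP.
    by move=> z; rewrite !inE => /orP [] /eqP ->; rewrite ?in_orbit.
  by rewrite cards2 eq_sym; case: eqP => //= _; lia.
- by rewrite map_inj_uniq ?orbit_uniq // => x y [].
- by rewrite all_map; apply/allP => m _ /=.
- rewrite cycle_map; apply: (@sub_in_cycle _ (mem (orbit f h)) (frel f)) cyc; last exact/allP.
  by move=> x y xo _ /eqP <- /=; apply: next_man_next; apply: nx.
Qed.

Lemma pairs_of_eliminate rho (p : matching n) : exposed I M rho ->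
  (forall m, p m = if m \in unzip1 rho then M (f m) else M m) ->
  pairs_of p = eliminate M rho.
Proof.
move=> ex pE; have [_ nx] := exposed_fcycle ex.
apply/setP => -[m w]; rewrite in_eliminate // inE /= pE; case: ifP => // mr.
apply/eqP/idP => [<-|nw]; first exact/next_man_next/nx.
by apply: is_next_unique nw; apply/next_man_next/nx.
Qed.

(** Any man i of a rotation detects it: iterating [f] from i never leaves the rotation, so [h i]
    lies on it. Conversely the orbit of each [h i] is a rotation, so no entry is spurious. *)
Lemma eliminations_correct t (h : 'I_n -> 'I_n) (E : 'I_n -> matching n) :
  0 < n -> n <= t ->
  (forall i, fcycle f (orbit f (h i)) /\ next_woman (h i)) ->
  (forall i, next_woman (iter t f i) -> h i = iter t f i) ->
  (forall i m, E i m = if m \in orbit f (h i) then M (f m) else M m) ->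
  correct_answer I M (Eliminations [seq E i | i <- enum 'I_n]).
Proof.
move=> n0 nt hc hg EE; split.
- by move/(congr1 size)/eqP; rewrite size_map size_enum_ord eqn0Ngt n0.
- move=> rho ex; have [cyc nx] := exposed_fcycle ex.
  have [i ir] : exists i, i \in unzip1 rho.
    by case: ex; case: rho {cyc nx} => [//|p r] _ _ _ _; exists p.1; rewrite inE eqxx.
  have it j : iter j f i \in unzip1 rho.
    by elim: j => //= j IH; rewrite (eqP (next_cycle cyc IH)) mem_next.
  have hi := hg i (nx _ (it t)).
  exists (E i); first by rewrite map_f ?mem_enum.
  apply: (pairs_of_eliminate ex) => m.
  rewrite EE hi (_ : (m \in orbit f _) = (m \in unzip1 rho)) //.
  apply/idP/idP => [|mr]; last by rewrite (in_orbit_cycle cyc (it t) mr).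
  by rewrite -fconnect_orbit => /iter_findex <-; rewrite -iterD.
- move=> _ /mapP [i _ ->]; have [cyc nx] := hc i; split.
    apply: stable_shift => m; rewrite EE; case: ifP => mo; [right|by left].
    exact/next_man_next/(cyclic_next cyc nx).
  have ex := rotation_exposed cyc nx.
  exists [seq (m, M m) | m <- orbit f (h i)] => //.
  by apply: pairs_of_eliminate => // m; rewrite EE /unzip1 -map_comp map_id.
Qed.

End Rotations.

(** * The algorithm *)

Definition Plus1 e := Op Add e (Lit 1).
Definition Side := Plus1 Len.
Definition Block j e := Get (Op Add (Op Mul (Lit j) Vol) e).
(** Arithmetic selection instead of a jump keeps processors in lockstep; a meaningless value in the
    discarded branch is multiplied by 0. *)
Definition If c x y := Op Add (Op Mul (Op Eq c (Lit 0)) y) (Op Mul (Op Lt (Lit 0) c) x).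

(* Processor ((a * (n + 1)) + b) * (n + 1) + r works on the triple (a, b, r). *)
Definition Fst := Op Div (Op Div Me Side) Side.
Definition Snd := Op Mod (Op Div Me Side) Side.
Definition Thd := Op Mod Me Side.

Definition MenPref m r := Get (Op Add (Op Add (Lit 1) (Op Mul m Len)) r).
Definition WomenPref w r :=
  Get (Op Add (Op Add (Op Add (Lit 1) (Op Mul Len Len)) (Op Mul w Len)) r).
Definition Wife m := Get (Op Add (Op Add (Lit 1) (Op Mul (Lit 2) (Op Mul Len Len))) m).

(* Pointer jumping: the rounds of [chase j e] iterate the map [e] of the
   processor numbers at least n times. *)
Definition Jump j := Block j (Block j Me).
Definition chase j e := [:: Store j e; Iterate j (Jump j)].
(* [Found j u] is the first r < n at which [q] holds in row u of block j, or n. *)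
Definition Search q := If (Op Add (Op Eq Thd Len) q) Me (Plus1 Me).
Definition Found j u := Op Mod (Block j (Op Mul u Side)) Side.

(* The first of [m] and her husband on the list of [w]; no man has number n, so
   [m] = n gives the husband. *)
Definition MetFirst w m := WomenPref w (Found 1 (Op Add (Op Mul w Side) m)).
Definition Husband w := MetFirst w Len.
Definition NextRank m := Found 2 m.
Definition HasNext m := Op Lt (NextRank m) Len.
Definition NextWoman m := MenPref m (NextRank m).
Definition NextMan m := If (HasNext m) (Husband (NextWoman m)) m.
(* The place reached from [x] along [NextMan], stopping at [a].  As nobody has
   number n, [Limit x] never stops and lies on the cycle into which [x] runs. *)
Definition Walk a x := Op Mod (Block 3 (Op Add (Op Mul a (Op Mul Side Side)) x)) Side.
Definition Limit x := Walk Len x.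
Definition FirstGood := Found 4 (Lit 0).

(** The sum serves as a disjunction. The husband is recognised by his wife, so [M] need not be
    inverted beforehand. *)
Definition Meets :=
  Op Add (Op Eq (WomenPref Fst Thd) Snd) (Op Eq (Wife (WomenPref Fst Thd)) Fst).
(** She prefers man [Snd] to her husband exactly when the one she meets first is married to somebody
    else. *)
Definition Improves :=
  let w := MenPref Snd Thd in Op Eq (Op Eq (Wife (MetFirst w Snd)) w) (Lit 0).
Definition StepTo :=
  If (Op Add (Op Eq Thd Len) (Op Eq Thd Fst)) Me
     (Op Add (Op Mul (Op Div Me Side) Side) (NextMan Thd)).
Definition Good := HasNext (Limit Thd).

(* The i-th matching of the output eliminates the cycle through [h]: the one into
   which i runs or, if i runs into a fixed point, the one of [FirstGood]. *)
Definition Entry :=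
  let q := Op Defs.Sub Me (Lit 3) in
  let i := Op Div q Len in
  let m := Op Mod q Len in
  let h := If (HasNext (Limit i)) (Limit i) (Limit FirstGood) in
  If (Op Eq (Walk m h) m) (NextWoman m) (Wife m).

(** Cell 0 is the length of the output: 1 for [WomanOptimal], whose code 0 is in cell 1; otherwise
    two header cells and n * n entries. *)
Definition Answer :=
  If (Op Eq FirstGood Len)
    (If Me (Lit 0) (Lit 1))
    (If (Op Eq Me (Lit 0)) (Op Add (Op Mul Len Len) (Lit 2))
    (If (Op Eq Me (Lit 1)) (Lit 1)
    (If (Op Eq Me (Lit 2)) Len Entry))).

(** The answer overwrites the input in block 0. This is safe because it is the last statement and a
    store reads before it writes. *)
Definition algorithm :=
  chase 1 (Search Meets) ++ chase 2 (Search Improves) ++ chase 3 StepTo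
  ++ chase 4 (Search Good) ++ [:: Store 0 Answer].

(** * Correctness of the algorithm *)

Section Semantics.
Variable n : nat.
Local Notation s := n.+1.
Local Notation K := (volume n).
Local Notation E mem p e := (eval n mem p e).
Local Notation T := (2 ^ (trunc_log 2 n).+1).
Implicit Types mem : nat -> nat.

Lemma volumeE : K = s * s * s.
Proof. by rewrite /volume !expnS expn0 muln1 mulnA. Qed.

Lemma eval_If mem p c x y :
  E mem p (If c x y) = if E mem p c == 0 then E mem p y else E mem p x.
Proof. by rewrite /=; case: (E mem p c) => [|v] /=; rewrite !(mul1n, mul0n, addn0). Qed.

Lemma eval_Block mem p j e : E mem p (Block j e) = mem (j * K + E mem p e).
Proof. by []. Qed.

Lemma eval_Side mem p : E mem p Side = s.
Proof. by rewrite /= addn1. Qed.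

Lemma eval_Found mem p j u : E mem p (Found j u) = mem (j * K + E mem p u * s) %% s.
Proof. by rewrite /= addn1. Qed.

Lemma eval_Walk mem p a x :
  E mem p (Walk a x) = mem (3 * K + (E mem p a * (s * s) + E mem p x)) %% s.
Proof. by rewrite /= addn1. Qed.

Lemma exec_seq_cat c1 c2 mem : exec_seq n (c1 ++ c2) mem = exec_seq n c2 (exec_seq n c1 mem).
Proof. exact: foldl_cat. Qed.

Lemma exec_store_in j e mem p : p < K -> exec_store n j e mem (j * K + p) = E mem p e %% K.+1.
Proof.
move=> pK; rewrite /exec_store /store divnMDl ?volume_gt0 // divn_small // addn0 eqxx.
by rewrite modnMDl (modn_small pK).
Qed.

Lemma exec_store_out j j' e mem p : j' != j -> p < K ->
  exec_store n j e mem (j' * K + p) = mem (j' * K + p).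
Proof.
move=> jj pK; rewrite /exec_store /store divnMDl ?volume_gt0 // divn_small // addn0.
by rewrite (negbTE jj).
Qed.

(** Each jump composes the stored map with itself, so i rounds after the first store give 2 ^ i
    iterations. The map must stay in the block for every cell to be a valid pointer. *)
Lemma chase_in mem j e p : (forall q, q < K -> E mem q e < K) -> p < K ->
  exec_seq n (chase j e) mem (j * K + p) = iter T (fun q => E mem q e) p.
Proof.
move=> phK; rewrite /exec_seq /= -/(iter _.+1 _ _).
set mem0 := exec_store n j e mem; set phi := fun q => _.
have itK i q : q < K -> iter i phi q < K by elim: i => //= i IH /IH /phK.
suff it i q : q < K -> iter i (exec_store n j (Jump j)) mem0 (j * K + q) = iter (2 ^ i) phi q.
  exact: it.
elim: i q => [|i IH] q qK.
  by rewrite /= /mem0 exec_store_in // modn_small // ltnS ltnW // phK.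
rewrite iterS exec_store_in // !eval_Block /= !IH ?itK //.
by rewrite -iterD addnn -mul2n -expnS modn_small // ltnS ltnW // itK.
Qed.

Lemma chase_out mem j j' e p : j' != j -> p < K ->
  exec_seq n (chase j e) mem (j' * K + p) = mem (j' * K + p).
Proof.
move=> jj pK; rewrite /exec_seq /= -/(iter _.+1 _ _).
suff it i m : iter i (exec_store n j (Jump j)) m (j' * K + p) = m (j' * K + p).
  by rewrite it exec_store_out.
by elim: i => // i IH; rewrite iterS exec_store_out.
Qed.

Lemma rounds_gt : n < T.
Proof. exact: trunc_log_ltn. Qed.

Lemma index_lt u r : u < s * s -> r <= n -> u * s + r < K.
Proof.
move=> us rn; rewrite volumeE; apply: (@leq_trans (u.+1 * s)); last by rewrite leq_mul2r us orbT.
by rewrite mulSn addnC ltn_add2r.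
Qed.

Lemma index_lt2 a r : a <= n -> r <= n -> a * (s * s) + r < K.
Proof.
by move=> an rn; rewrite mulnA; apply: index_lt => //; rewrite ltn_mul2r.
Qed.

Lemma div_index u r : r <= n -> (u * s + r) %/ s = u.
Proof. by move=> rn; rewrite divnMDl // divn_small // addn0. Qed.

Lemma mod_index u r : r <= n -> (u * s + r) %% s = r.
Proof. by move=> rn; rewrite modnMDl modn_small. Qed.

Lemma eval_Thd mem u r : r <= n -> E mem (u * s + r) Thd = r.
Proof. by move=> rn; rewrite -[LHS]/((u * s + r) %% (n + 1)) addn1 mod_index. Qed.

Lemma eval_Snd mem a b r : b <= n -> r <= n -> E mem ((a * s + b) * s + r) Snd = b.
Proof.
move=> bn rn; rewrite -[LHS]/(((a * s + b) * s + r) %/ (n + 1) %% (n + 1)) addn1.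
by rewrite div_index // mod_index.
Qed.

Lemma eval_Fst mem a b r : b <= n -> r <= n -> E mem ((a * s + b) * s + r) Fst = a.
Proof.
move=> bn rn; rewrite -[LHS]/(((a * s + b) * s + r) %/ (n + 1) %/ (n + 1)) addn1.
by rewrite !div_index.
Qed.

Lemma eval_Search mem u r q : r <= n ->
  E mem (u * s + r) (Search q) =
  u * s + (if (r == n) || (E mem (u * s + r) q != 0) then r else r.+1).
Proof.
move=> rn; rewrite eval_If.
rewrite -[E _ _ (Op Add _ _)]/((E mem (u * s + r) Thd == n) + E mem (u * s + r) q).
rewrite eval_Thd // addn_eq0 eqb0 -[E _ _ (Plus1 Me)]/(u * s + r + 1) addn1 -addnS.
by rewrite -[E _ _ Me]/(u * s + r); case: (r == n); case: (E mem _ q).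
Qed.

Lemma search_spec mem j q u : u < s * s ->
  exec_seq n (chase j (Search q)) mem (j * K + u * s) %% s =
  find (fun r => E mem (u * s + r) q != 0) (iota 0 n).
Proof.
move=> us; set Q := fun r => _.
have fn : find Q (iota 0 n) <= n by rewrite -[X in _ <= X](size_iota 0) find_size.
have uK : u * s < K by have := index_lt us (leq0n n); rewrite addn0.
rewrite chase_in //; last first.
  move=> p pK; rewrite (divn_eq p s) eval_Search ?leq_mod //; last by rewrite -ltnS ltn_mod.
  have ps : p %/ s < s * s by rewrite ltn_divLR // -volumeE.
  have : p %% s <= n by rewrite -ltnS ltn_mod.
  rewrite leq_eqVlt; case: eqP => [->|_ /= rn] /=; first by rewrite index_lt.
  by case: ifP => _; rewrite index_lt // ltnW.
(* [find] returns n when nothing is found, and this is where the search halts anyway. *)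
suff it i : iter i (fun p => E mem p (Search q)) (u * s) = u * s + minn i (find Q (iota 0 n)).
  by rewrite it mod_index (minn_idPr _) // (leq_trans fn) // ltnW // rounds_gt.
elim: i => [|i IH]; first by rewrite min0n addn0.
rewrite iterS IH eval_Search; last by rewrite geq_min fn orbT.
congr (_ + _); rewrite -/(Q _); case: (ltnP i (find Q (iota 0 n))) => hi.
  rewrite (minn_idPl hi).
  have i_n := leq_trans hi fn.
  have := before_find 0 hi; rewrite nth_iota // add0n => ->.
  by rewrite ltn_eqF.
rewrite (minn_idPr (leqW hi)).
case: (ltngtP (find Q (iota 0 n)) n) fn => // fn _.
have := @nth_find _ 0 Q (iota 0 n); rewrite has_find size_iota nth_iota // add0n.
by move=> ->.
Qed.

Lemma find_min (Q : pred nat) a b : a < n -> b < n ->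
  (forall r, r < n -> Q r = (r == a) || (r == b)) -> find Q (iota 0 n) = minn a b.
Proof.
move=> an bn QE; have mn : minn a b < n by rewrite gtn_min an.
apply/eqP; rewrite eqn_leq; apply/andP; split.
  rewrite leqNgt; apply/negP => /(before_find 0).
  by rewrite nth_iota // add0n QE // /minn; case: ifP; rewrite eqxx ?orbT.
rewrite leqNgt; apply/negP => lt.
have fn := ltn_trans lt mn.
have := @nth_find _ 0 Q (iota 0 n); rewrite has_find size_iota nth_iota // add0n fn QE //.
by move=> /(_ isT) /orP [] /eqP e; move: lt; rewrite e leq_min ltnn ?andbF.
Qed.

End Semantics.

Lemma size_flatten_rows T k (ss : seq (seq T)) :
  all (fun r => size r == k) ss -> size (flatten ss) = size ss * k.
Proof. by elim: ss => //= r ss IH /andP [/eqP sr /IH]; rewrite size_cat sr => ->. Qed.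

Lemma nth_flatten_rows T (x0 : T) k (ss : seq (seq T)) i r :
  all (fun r => size r == k) ss -> r < k ->
  nth x0 (flatten ss) (i * k + r) = nth x0 (nth [::] ss i) r.
Proof.
move=> + rk; elim: ss i => [|row ss IH] i /=; first by rewrite !nth_nil.
case/andP=> /eqP sr all_k; rewrite nth_cat sr; case: i => [|i]; first by rewrite rk.
by rewrite mulSn -addnA ltnNge leq_addr /= addKn IH.
Qed.

(** * Layout of the encoded input *)

Section Encoding.
Variable n : nat.

Lemma nth_encode_perm (p : {perm 'I_n}) (r : 'I_n) : nth 0 (encode_perm p) r = p r.
Proof. by rewrite (nth_map r) ?size_enum_ord // nth_ord_enum. Qed.

Lemma size_encode_perm (p : {perm 'I_n}) : size (encode_perm p) = n.
Proof. by rewrite size_map size_enum_ord. Qed.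

Lemma rows_encode_perm (F : 'I_n -> {perm 'I_n}) :
  all (fun r => size r == n) [seq encode_perm (F m) | m <- enum 'I_n].
Proof. by rewrite all_map; apply/allP => m _ /=; rewrite size_encode_perm. Qed.

Lemma size_perms (F : 'I_n -> {perm 'I_n}) :
  size (flatten [seq encode_perm (F m) | m <- enum 'I_n]) = n * n.
Proof. by rewrite (size_flatten_rows (rows_encode_perm F)) size_map size_enum_ord. Qed.

Lemma nth_perms (F : 'I_n -> {perm 'I_n}) (i r : 'I_n) :
  nth 0 (flatten [seq encode_perm (F m) | m <- enum 'I_n]) (i * n + r) = F i r.
Proof.
rewrite nth_flatten_rows ?rows_encode_perm //.
by rewrite (nth_map i) ?size_enum_ord // nth_ord_enum nth_encode_perm.
Qed.

Lemma index_lt_sq (i r : 'I_n) : i * n + r < n * n.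
Proof.
apply: (@leq_trans (i.+1 * n)); last by rewrite leq_mul2r ltn_ord orbT.
by rewrite mulSn addnC ltn_add2r.
Qed.

Variables (I : instance n) (M : matching n).

Lemma size_encode_input : size (encode_input I M) = (n * n + n * n + n).+1.
Proof. by rewrite /= !size_cat !size_perms size_encode_perm addnA. Qed.

Lemma nth_input_men (m r : 'I_n) : nth 0 (encode_input I M) (1 + m * n + r) = men_pref I m r.
Proof. by rewrite add1n addSn /= nth_cat size_perms index_lt_sq nth_perms. Qed.

Lemma nth_input_women (w r : 'I_n) :
  nth 0 (encode_input I M) (1 + n * n + w * n + r) = women_pref I w r.
Proof.
rewrite -!addnA add1n /= nth_cat size_perms ltnNge leq_addr /= addKn.
by rewrite nth_cat size_perms index_lt_sq nth_perms.
Qed.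

Lemma nth_input_matching (m : 'I_n) : nth 0 (encode_input I M) (1 + 2 * (n * n) + m) = M m.
Proof.
rewrite mul2n -addnn -!addnA add1n /= nth_cat size_perms ltnNge leq_addr /= addKn.
by rewrite nth_cat size_perms ltnNge leq_addr /= addKn nth_encode_perm.
Qed.

Lemma encode_input_le : all (fun v => v <= n) (encode_input I M).
Proof.
have permn (p : {perm 'I_n}) : all (fun v => v <= n) (encode_perm p).
  by rewrite all_map; apply/allP => r _ /=; rewrite ltnW.
have permsn (F : 'I_n -> {perm 'I_n}) :
    all (fun v => v <= n) (flatten [seq encode_perm (F m) | m <- enum 'I_n]).
  by elim: (enum _) => //= m ms IH; rewrite all_cat permn.
by rewrite /= leqnn !all_cat !permsn permn.
Qed.

End Encoding.

Lemma find_first (Q : pred nat) k a : a < k -> Q a -> (forall r, r < a -> ~~ Q r) ->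
  find Q (iota 0 k) = a.
Proof.
move=> ak Qa before; apply/eqP; rewrite eqn_leq; apply/andP; split.
  rewrite leqNgt; apply/negP => /(before_find 0).
  by rewrite nth_iota // add0n Qa.
rewrite leqNgt; apply/negP => lt; have fk := ltn_trans lt ak.
have := @nth_find _ 0 Q (iota 0 k); rewrite has_find size_iota nth_iota // add0n fk.
by move=> /(_ isT); apply/negP/before.
Qed.

Lemma rankE n (L : {perm 'I_n}) (x r : 'I_n) : ((r : nat) == rank L x) = (L r == x).
Proof. by rewrite /rank; apply/eqP/eqP => [/val_inj ->|<-]; rewrite ?permKV ?permK. Qed.

(** * Contents of the blocks after each phase *)

Section Run.
Variables (n : nat) (I : instance n) (M : matching n).
Hypothesis stM : stable I M.
Local Notation s := n.+1.
Local Notation K := (volume n).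
Local Notation E mem p e := (eval n mem p e).
Local Notation T := (2 ^ (trunc_log 2 n).+1).
Local Notation f := (next_man I M).
Implicit Types (mem : nat -> nat) (m w x : 'I_n).

Definition loaded mem := [/\
  forall m r : 'I_n, mem (1 + m * n + r) = men_pref I m r,
  forall w r : 'I_n, mem (1 + n * n + w * n + r) = women_pref I w r
  & forall m, mem (1 + 2 * (n * n) + m) = M m].

Definition met mem := forall w,
  (forall m, mem (1 * K + (w * s + m) * s) %% s =
     minn (rank (women_pref I w) m) (rank (women_pref I w) ((M^-1)%g w))) /\
  mem (1 * K + (w * s + n) * s) %% s = rank (women_pref I w) ((M^-1)%g w).

Definition next_rank m : nat :=
  if next_woman I M m is Some w then rank (men_pref I m) w else n.

Definition ranked mem := forall m, mem (2 * K + m * s) %% s = next_rank m.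

(** The stop [a] is a number rather than a man so that a = n gives the walk without stop. *)
Definition walk_step (a : nat) x := if (x : nat) == a then x else f x.

Definition walked mem := forall a x, a <= n ->
  mem (3 * K + (a * (s * s) + x)) %% s = iter T (walk_step a) x.

Definition first_good mem :=
  mem (4 * K + 0 * s) %% s = find (fun i =>
    if insub i is Some x then next_woman I M (iter T f x) : bool else false) (iota 0 n).

Lemma loaded_input : loaded (nth 0 (encode_input I M)).
Proof.
by split=> *; [apply: nth_input_men | apply: nth_input_women | apply: nth_input_matching].
Qed.

(** The input fits into block 0 and so survives the stores to other blocks. *)
Lemma input_lt_volume : (n * n + n * n + n).+1 <= K.
Proof. by rewrite volumeE; nia. Qed.

Lemma loaded_chase mem j e : j != 0 -> loaded mem -> loaded (exec_seq n (chase j e) mem).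
Proof.
rewrite eq_sym => j0 [lm lw lM]; have szK := input_lt_volume.
have out a : a < K -> exec_seq n (chase j e) mem a = mem a.
  by move=> aK; have := chase_out mem e j0 aK; rewrite mul0n.
split=> [m r|w r|m].
- by rewrite out ?lm //; apply: leq_trans szK; have := index_lt_sq m r; lia.
- by rewrite out ?lw //; apply: leq_trans szK; have := index_lt_sq w r; lia.
- by rewrite out ?lM //; apply: leq_trans szK; have := ltn_ord m; lia.
Qed.

Lemma met_chase mem j e : j != 1 -> met mem -> met (exec_seq n (chase j e) mem).
Proof.
rewrite eq_sym => j1 mt w; have [mt1 mt2] := mt w.
have lt r : r <= n -> (w * s + r) * s < K.
  move=> rn; rewrite -[_ * s]addn0; apply: index_lt => //.
  by have := ltn_ord w; nia.
split=> [m|]; rewrite chase_out //; apply: lt => //; exact: ltnW.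
Qed.

Lemma ranked_chase mem j e : j != 2 -> ranked mem -> ranked (exec_seq n (chase j e) mem).
Proof.
rewrite eq_sym => j2 rk m; rewrite chase_out //.
by rewrite -[_ * s]addn0; apply: index_lt => //; have := ltn_ord m; nia.
Qed.

Lemma walked_chase mem j e : j != 3 -> walked mem -> walked (exec_seq n (chase j e) mem).
Proof.
rewrite eq_sym => j3 wk a x an; rewrite chase_out ?wk //.
by apply: index_lt2 => //; apply: ltnW.
Qed.

Section Evaluate.
Variables (mem : nat -> nat) (p : nat).
Hypothesis ld : loaded mem.

Lemma eval_MenPref em er m (r : 'I_n) : E mem p em = m -> E mem p er = r ->
  E mem p (MenPref em er) = men_pref I m r.
Proof. by case: ld => lm _ _ /= -> ->; apply: lm. Qed.

Lemma eval_WomenPref ew er w (r : 'I_n) : E mem p ew = w -> E mem p er = r ->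
  E mem p (WomenPref ew er) = women_pref I w r.
Proof. by case: ld => _ lw _ /= -> ->; apply: lw. Qed.

Lemma eval_Wife em m : E mem p em = m -> E mem p (Wife em) = M m.
Proof. by case: ld => _ _ lM /= ->; apply: lM. Qed.

Hypothesis mt : met mem.

Lemma eval_MetFirst ew em w m : E mem p ew = w -> E mem p em = m ->
  E mem p (MetFirst ew em) = nat_of_ord (if improves I M m w then m else (M^-1)%g w).
Proof.
move=> ewE emE; pose L := women_pref I w.
have [/(_ m) met1 _] := mt w.
have -> : E mem p (MetFirst ew em) =
    L (if improves I M m w then (L^-1)%g m else (L^-1)%g ((M^-1)%g w)).
  apply: eval_WomenPref => //; rewrite eval_Found.
  rewrite -[E mem p (Op Add _ _)]/(E mem p ew * E mem p Side + E mem p em).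
  by rewrite eval_Side ewE emE met1 /improves /woman_prefers /minn; case: ifP.
by case: ifP; rewrite permKV.
Qed.

Lemma eval_Husband ew w : E mem p ew = w -> E mem p (Husband ew) = (M^-1)%g w.
Proof.
move=> ewE; pose L := women_pref I w; have [_ met2] := mt w.
rewrite -[(M^-1)%g w in RHS](permKV L); apply: eval_WomenPref => //; rewrite eval_Found.
rewrite -[E mem p (Op Add _ _)]/(E mem p ew * E mem p Side + n).
by rewrite eval_Side ewE met2.
Qed.

Hypothesis rk : ranked mem.

Lemma eval_NextRank em m : E mem p em = m -> E mem p (NextRank em) = next_rank m.
Proof. by move=> emE; rewrite eval_Found emE rk. Qed.

Lemma eval_HasNext em m : E mem p em = m -> E mem p (HasNext em) = next_woman I M m.
Proof.
move=> emE; rewrite -[LHS]/(nat_of_bool (E mem p (NextRank em) < n)) (eval_NextRank emE).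
by rewrite /next_rank; case: next_woman => [w|]; rewrite ?ltn_ord ?ltnn.
Qed.

Lemma eval_NextWoman em m : next_woman I M m -> E mem p em = m ->
  E mem p (NextWoman em) = M (f m).
Proof.
move=> nm emE; have nr := eval_NextRank emE.
rewrite /next_rank in nr; rewrite /next_man.
case: next_woman nm nr => [w|//] _ nr; rewrite permKV.
by rewrite (eval_MenPref emE nr) permKV.
Qed.

Lemma eval_NextMan em m : E mem p em = m -> E mem p (NextMan em) = f m.
Proof.
move=> emE; rewrite eval_If (eval_HasNext emE) eqb0; case: ifPn => nm.
  by rewrite emE /next_man; case: next_woman nm.
by rewrite (eval_Husband (eval_NextWoman (negbNE nm) emE)) permK.
Qed.

Hypothesis wk : walked mem.

Lemma eval_Limit ex x : E mem p ex = x -> E mem p (Limit ex) = iter T f x.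
Proof.
move=> exE; rewrite eval_Walk -[E mem p Len]/n exE wk //; congr nat_of_ord.
by apply: eq_iter => y; rewrite /walk_step ltn_eqF.
Qed.

Lemma eval_Walk_orbit ea ex m x : E mem p ea = m -> E mem p ex = x ->
  (E mem p (Walk ea ex) == m) = (m \in orbit f x).
Proof.
move=> eaE exE; rewrite eval_Walk eaE exE wk; last exact: ltnW.
by rewrite -(@in_orbit_stop _ I M T) // ltnW // rounds_gt.
Qed.

End Evaluate.

Lemma met_search mem : loaded mem -> met (exec_seq n (chase 1 (Search Meets)) mem).
Proof.
move=> ld w; set L := women_pref I w.
have us r : r <= n -> w * s + r < s * s by have := ltn_ord w; nia.
have meetsE r (y : 'I_n) : r <= n ->
    E mem ((w * s + r) * s + y) Meets = ((L y : nat) == r) + (M (L y) == w).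
  move=> rn; have yn := ltnW (ltn_ord y).
  have wpE : E mem ((w * s + r) * s + y) (WomenPref Fst Thd) = L y.
    by apply: eval_WomenPref => //; rewrite ?eval_Thd ?eval_Fst.
  rewrite -[LHS]/((E mem _ (WomenPref Fst Thd) == E mem _ Snd) +
                  (E mem _ (Wife (WomenPref Fst Thd)) == E mem _ Fst)).
  by rewrite (eval_Wife ld wpE) wpE eval_Snd ?eval_Fst.
have MinvE y : (M y == w) = (y == (M^-1)%g w).
  by apply/eqP/eqP => [<-|->]; rewrite ?permK ?permKV.
split=> [m|]; rewrite search_spec ?us //; try exact: ltnW.
  apply: find_min => [||r rn]; rewrite /rank ?ltn_ord //.
  rewrite -[r]/(nat_of_ord (Ordinal rn)) !rankE meetsE; last exact: ltnW.
  by rewrite addn_eq0 !eqb0 negb_and !negbK MinvE.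
(* Row n has the husband as its only hit, a case of two hits that coincide. *)
rewrite -[RHS]minnn; apply: find_min => [||r rn]; rewrite /rank ?ltn_ord //.
rewrite -[r]/(nat_of_ord (Ordinal rn)) !rankE meetsE // (ltn_eqF (ltn_ord (L _))) add0n.
by rewrite eqb0 negbK MinvE orbb.
Qed.

Lemma ranked_search mem : loaded mem -> met mem ->
  ranked (exec_seq n (chase 2 (Search Improves)) mem).
Proof.
move=> ld mt m; rewrite search_spec; last by have := ltn_ord m; nia.
set Q := fun r => _; pose L := men_pref I m.
have QE (r : 'I_n) : Q r = improves I M m (L r).
  have rn := ltnW (ltn_ord r); have mn := ltnW (ltn_ord m).
  (* Row m of this block consists of the triples (0, m, r). *)
  rewrite /Q (_ : m * s + r = (0 * s + m) * s + r) //.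
  have sndE := eval_Snd mem 0 mn rn; have thdE := eval_Thd mem (0 * s + m) rn.
  have wE := eval_MenPref ld sndE thdE.
  have metE := eval_Wife ld (eval_MetFirst ld mt wE sndE).
  rewrite -[E _ _ Improves]/(nat_of_bool (nat_of_bool
     (E mem _ (Wife (MetFirst (MenPref Snd Thd) Snd)) == E mem _ (MenPref Snd Thd)) == 0)).
  rewrite wE metE eqb0 negbK eqb0 /=; case: ifP => imp; last by rewrite permKV eqxx.
  apply/negP => /eqP /val_inj mL; move: imp; rewrite -/(L r) -mL.
  by rewrite /improves permK /woman_prefers ltnn.
rewrite /next_rank; case nw: next_woman => [w|].
  have := iffLR (next_womanP I M m w) nw => isn.
  have /andP [imp /forallP min] := isn; rewrite next_candidateE // in imp.
  rewrite /rank -/L; apply: find_first => //.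
    by rewrite QE permKV.
  move=> r rw; have rn := ltn_trans rw (ltn_ord _).
  rewrite -[r]/(nat_of_ord (Ordinal rn)) QE; apply/negP => impr.
  have := min (L (Ordinal rn)); rewrite next_candidateE // impr /= /man_prefers /rank permK.
  by rewrite rw.
rewrite hasNfind ?size_iota //; apply/hasPn => r; rewrite mem_iota add0n /= => rn.
rewrite -[r]/(nat_of_ord (Ordinal rn)) QE; apply/negP => /(improves_next stM) [w [nw' _]].
by have := iffRL (next_womanP I M m w) nw'; rewrite nw.
Qed.

Lemma walked_chase3 mem : loaded mem -> met mem -> ranked mem ->
  walked (exec_seq n (chase 3 StepTo) mem).
Proof.
move=> ld mt rk a x an.
have stepE b c (y : 'I_n) : b <= n -> c <= n ->
    E mem ((b * s + c) * s + y) StepTo = (b * s + c) * s + walk_step b y.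
  move=> bn cn; have yn := ltnW (ltn_ord y).
  rewrite eval_If; set q := _ + y.
  have thdE : E mem q Thd = y by rewrite eval_Thd.
  rewrite -[E mem q (Op Add (Op Eq _ _) _)]/((E mem q Thd == n) + (E mem q Thd == E mem q Fst)).
  rewrite -[E mem q (Op Add (Op Mul _ _) _)]/((q %/ E mem q Side) * E mem q Side + E mem q (NextMan Thd)).
  rewrite (eval_NextMan ld mt rk thdE) thdE eval_Fst // eval_Side div_index //.
  rewrite (ltn_eqF (ltn_ord y)) add0n eqb0 /walk_step.
  by case: ((y : nat) == b).
(* Pointer jumping also needs this at cells whose last coordinate is n, which stand for no man;
   [StepTo] fixes them. *)
have small q : q < K -> E mem q StepTo < K.
  move=> qK; have qn : q %% s <= n by rewrite -ltnS ltn_mod.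
  have qqn : q %/ s %% s <= n by rewrite -ltnS ltn_mod.
  have ss : q %/ s < s * s by rewrite ltn_divLR // -volumeE.
  have bn : q %/ s %/ s <= n by rewrite -ltnS ltn_divLR.
  move: qn; rewrite leq_eqVlt => /orP [/eqP qn|qn].
    rewrite eval_If -[E mem q (Op Add (Op Eq _ _) _)]/((E mem q Thd == n) + (E mem q Thd == E mem q Fst)).
    by rewrite -[E mem q Thd]/(q %% (n + 1)) addn1 qn eqxx.
  have -> : q = (q %/ s %/ s * s + q %/ s %% s) * s + Ordinal qn by rewrite -!divn_eq.
  rewrite stepE // -divn_eq; apply: index_lt => //; exact: ltnW.
rewrite chase_in //; last by apply: index_lt2 => //; apply: ltnW.
suff -> i : iter i (fun q => E mem q StepTo) (a * (s * s) + x) =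
    (a * s + 0) * s + iter i (walk_step a) x by rewrite mod_index // ltnW.
elim: i => [|i IH]; first by rewrite addn0 -mulnA.
by rewrite iterS IH stepE.
Qed.

Lemma first_good_search mem : loaded mem -> met mem -> ranked mem -> walked mem ->
  first_good (exec_seq n (chase 4 (Search Good)) mem).
Proof.
move=> ld mt rk wk; rewrite /first_good search_spec //.
apply: eq_in_find => i; rewrite mem_iota add0n => /andP [_ i_n].
rewrite insubT; set x : 'I_n := Sub i _.
rewrite -[RHS]/(isSome (next_woman I M (iter T f x))).
have thdE : E mem (0 * s + i) Thd = x by rewrite eval_Thd // ltnW.
by rewrite /Good (eval_HasNext rk (eval_Limit wk thdE)) eqb0 negbK.
Qed.

Definition memory := exec_seq n (chase 1 (Search Meets) ++ chase 2 (Search Improves) ++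
  chase 3 StepTo ++ chase 4 (Search Good)) (nth 0 (encode_input I M)).

Lemma memoryP :
  [/\ loaded memory, met memory, ranked memory, walked memory & first_good memory].
Proof.
rewrite /memory !exec_seq_cat.
set mem1 := exec_seq n (chase 1 _) _.
have l1 : loaded mem1 by apply: loaded_chase => //; apply: loaded_input.
have m1 : met mem1 by apply: met_search; apply: loaded_input.
set mem2 := exec_seq n (chase 2 _) _.
have l2 : loaded mem2 by apply: loaded_chase.
have m2 : met mem2 by apply: met_chase.
have r2 : ranked mem2 by apply: ranked_search.
set mem3 := exec_seq n (chase 3 _) _.
have l3 : loaded mem3 by apply: loaded_chase.
have m3 : met mem3 by apply: met_chase.
have r3 : ranked mem3 by apply: ranked_chase.
have w3 : walked mem3 by apply: walked_chase3.
split; [exact: loaded_chase | exact: met_chase | exact: ranked_chase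
  | exact: walked_chase | exact: first_good_search].
Qed.

Definition result := exec_seq n algorithm (nth 0 (encode_input I M)).

Lemma result_in p : p < K -> result p = E memory p Answer %% K.+1.
Proof.
move=> pK; rewrite /result /algorithm !catA exec_seq_cat -!catA.
by have := exec_store_in 0 Answer memory pK; rewrite mul0n.
Qed.

(** For n = 0 blocks have one cell, so cell 1 belongs to block 1 and is out of reach of the final
    store; it holds the result of the first search, which stands still at 0. *)
Lemma result_empty : n = 0 -> result 1 = 0.
Proof.
move=> n0; have K1 : K = 1 by rewrite volumeE n0.
have out j e mem : j != 1 -> exec_seq n (chase j e) mem 1 = mem 1.
  rewrite eq_sym => j1; have := @chase_out n mem j 1 e 0 j1; rewrite K1.
  by apply.
rewrite /result /algorithm !exec_seq_cat.
set mem4 := exec_seq n (chase 4 _) _.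
have -> : exec_seq n [:: Store 0 Answer] mem4 1 = mem4 1.
  by have := @exec_store_out n 0 1 Answer mem4 0; rewrite K1; apply.
rewrite /mem4 (out 4) // (out 3) // (out 2) //.
set inp := nth 0 _.
have fix0 : E inp 0 (Search Meets) = 0.
  by have := eval_Search inp 0 Meets (leq0n n); rewrite n0.
have := @chase_in n inp 1 (Search Meets) 0; rewrite K1 => chaseE.
rewrite -[LHS]/(exec_seq n (chase 1 (Search Meets)) inp (1 * 1 + 0)) chaseE //; last first.
  by case=> // _; rewrite fix0.
by elim: T => // i IH; rewrite iterS IH.
Qed.

End Run.

(** * From the memory to the answer *)

Section Final.
Variables (n : nat) (I : instance n) (M : matching n).
Hypothesis stM : stable I M.
Local Notation s := n.+1.
Local Notation K := (volume n).
Local Notation E mem p e := (eval n mem p e).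
Local Notation T := (2 ^ (trunc_log 2 n).+1).
Local Notation f := (next_man I M).
Local Notation memory := (memory I M).
Local Notation result := (result I M).
Implicit Types (m x : 'I_n).

Lemma eval_Answer p : E memory p Answer =
  if E memory p FirstGood == n then (p == 0 : nat)
  else if p == 0 then n * n + 2 else if p == 1 then 1 else if p == 2 then n
  else E memory p Entry.
Proof.
have eqE a b : E memory p (Op Eq a b) = (E memory p a == E memory p b) by [].
rewrite /Answer !eval_If !eqE !eqb0 -[E memory p Len]/n -[E memory p Me]/p.
rewrite -[E memory p (Lit 0)]/0 -[E memory p (Lit 1)]/1 -[E memory p (Lit 2)]/2.
by rewrite !if_neg; case: (p == 0).
Qed.

Definition good x : bool := next_woman I M (iter T f x).

Lemma eval_FirstGood p : E memory p FirstGood =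
  find (fun j => if insub j is Some x then good x else false) (iota 0 n).
Proof. by have [_ _ _ _ <-] := memoryP stM; rewrite eval_Found. Qed.

Lemma FirstGood_none p : (forall i, ~~ good i) -> E memory p FirstGood = n.
Proof.
move=> none; rewrite eval_FirstGood hasNfind ?size_iota //.
by apply/hasPn => i _; case: insubP.
Qed.

Lemma FirstGood_some i : good i ->
  exists2 i0, good i0 & forall p, E memory p FirstGood = i0.
Proof.
move=> gi; set Q := fun j : nat => if insub j is Some x then good x else false.
have hQ : has Q (iota 0 n).
  by apply/hasP; exists (i : nat); rewrite ?mem_iota ?add0n ?ltn_ord //= /Q valK.
have fn : find Q (iota 0 n) < n by rewrite -[X in _ < X](size_iota 0) -has_find.
exists (Ordinal fn); last by move=> p; rewrite eval_FirstGood.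
by have := nth_find 0 hQ; rewrite nth_iota // add0n /Q insubT.
Qed.

Lemma eval_Entry (i0 i : 'I_n) m : good i0 ->
  (forall p, E memory p FirstGood = i0) ->
  let h := iter T f (if good i then i else i0) in
  E memory (3 + (i * n + m)) Entry = nat_of_ord (if m \in orbit f h then M (f m) else M m).
Proof.
move=> gi0 fg h; have [ld mt rk wk _] := memoryP stM.
set p := 3 + _; set q := Op Defs.Sub Me (Lit 3).
have n0 : 0 < n by apply: leq_trans (ltn_ord m).
have qE : E memory p q = i * n + m by rewrite -[LHS]/(p - 3) addKn.
have iE : E memory p (Op Div q Len) = i.
  by rewrite -[LHS]/(E memory p q %/ n) qE divnMDl // divn_small // addn0.
have mE : E memory p (Op Mod q Len) = m.
  by rewrite -[LHS]/(E memory p q %% n) qE modnMDl modn_small.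
have limE := eval_Limit wk iE; have lim0E := eval_Limit wk (fg p).
have hE : E memory p (If (HasNext (Limit (Op Div q Len)))
    (Limit (Op Div q Len)) (Limit FirstGood)) = h.
  rewrite eval_If (eval_HasNext rk limE) -/(good i) eqb0 if_neg limE lim0E /h.
  by case: (good i).
have hnext : next_woman I M h by rewrite /h; case: ifP.
have hcyc : fcycle f (orbit f h) by apply: iter_cyclic; apply/ltnW/rounds_gt.
rewrite /Entry -/q eval_If.
set b := E memory p (Op Eq _ _).
have -> : b = (m \in orbit f h) by rewrite -(eval_Walk_orbit wk mE hE) -mE.
rewrite eqb0 if_neg; case: ifP => mh; last exact: (eval_Wife ld mE).
by apply: (eval_NextWoman ld rk) => //; apply: cyclic_next mh.
Qed.

Lemma result_correct : exists2 a : answer n, correct_answer I M a &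
  [seq result i.+1 | i <- iota 0 (result 0)] = encode_answer a.
Proof.
have vol0 := volume_gt0 n.
case: (pickP good) => [i gi|none].
  have [i0 gi0 fg] := FirstGood_some gi.
  pose h i := iter T f (if good i then i else i0).
  have hcyc i' : fcycle f (orbit f (h i')) by apply: iter_cyclic; apply/ltnW/rounds_gt.
  have hnext i' : next_woman I M (h i') by rewrite /h; case: ifP.
  have [F FE] := fin_all_exists (fun i' => rotation_perm (hcyc i')).
  have n0 : 0 < n by apply: leq_trans (ltn_ord i).
  exists (Eliminations [seq F i' | i' <- enum 'I_n]).
    apply: (@eliminations_correct n I M stM T h) => //; first exact/ltnW/rounds_gt.
    by move=> j; rewrite /h /good => ->.
  have nK : n * n + 2 < K by rewrite volumeE; nia.
  (* Every output cell is at most [volume n], so the reduction made by the store does not change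
     it. *)
  have entry p : p <= n * n + 2 -> result p = E memory p Answer.
    move=> pn; rewrite result_in; last by apply: leq_ltn_trans nK.
    rewrite modn_small // ltnS eval_Answer fg ltn_eqF //.
    case: eqP => [_|p0]; first exact: ltnW.
    case: eqP => [_|p1]; first by lia.
    case: eqP => [_|p2]; first exact: leq_volume.
    pose r := p - 3; have rn : r < n * n by rewrite /r; lia.
    have pE : p = 3 + (r %/ n * n + r %% n) by rewrite -divn_eq /r; lia.
    have r1 : r %/ n < n by rewrite ltn_divLR.
    have r2 : r %% n < n by rewrite ltn_mod.
    rewrite pE (@eval_Entry i0 (Ordinal r1) (Ordinal r2) gi0 fg).
    by apply: leq_trans (leq_volume n); apply: ltnW.
  have r0 : result 0 = n * n + 2 by rewrite entry // eval_Answer fg ltn_eqF.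
  have r1 : result 1 = 1.
    by rewrite entry ?addn2 // eval_Answer fg (ltn_eqF (ltn_ord i0)).
  have r2 : result 2 = n.
    by rewrite entry ?addn2 // eval_Answer fg (ltn_eqF (ltn_ord i0)).
  rewrite r0 addn2 /= r1 r2 size_map size_enum_ord -map_comp; congr [:: _, _ & _].
  have sz := size_perms F.
  apply: (@eq_from_nth _ 0) => [|r]; first by rewrite size_map size_iota sz.
  rewrite size_map size_iota => rn; rewrite (nth_map 0) ?size_iota // nth_iota //.
  have d1 : r %/ n < n by rewrite ltn_divLR.
  have d2 : r %% n < n by rewrite ltn_mod.
  have rE : r = Ordinal d1 * n + Ordinal d2 by rewrite -divn_eq.
  rewrite [in RHS]rE nth_perms FE entry; last by lia.
  have -> : (2 + r).+1 = 3 + (Ordinal d1 * n + Ordinal d2) by rewrite -rE.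
  by rewrite eval_Answer fg ltn_eqF // (eval_Entry (Ordinal d1) (Ordinal d2) gi0 fg).
have fgn p : E memory p FirstGood = n by apply: FirstGood_none => i; rewrite none.
exists WomanOptimal.
  by apply: (@woman_optimal_if n I M stM T) => m; have /negbT := none m.
have r0 : result 0 = 1 by rewrite result_in // eval_Answer fgn eqxx modn_small.
suff r1 : result 1 = 0 by rewrite r0 /= r1.
case: (posnP n) => [n0|n0]; first exact: result_empty.
rewrite result_in ?eval_Answer ?fgn ?eqxx ?mod0n // volumeE; nia.
Qed.

End Final.

Theorem theorem9 :
  exists (prog : program) (k : nat),
    forall (n : nat) (I : instance n) (M : matching n),
      stable I M ->
      exists2 a : answer n,
        correct_answer I M a
        & NC_computes prog k (encode_input I M) (encode_answer a).
Proof.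
exists (machine algorithm).
exists (7 + (body_deg algorithm).*2 + size (machine algorithm)) => n I M stM.
have [a ca outE] := result_correct stM; exists a => //.
have [||||mem memE] := @machine_computes algorithm n
    (7 + (body_deg algorithm).*2 + size (machine algorithm)) (encode_input I M) erefl
    (encode_input_le I M).
(* The input has length 2n^2 + n + 1, whose square is at least (n + 1)^3. *)
- by rewrite size_encode_input volumeE expnS expn1; nia.
- by rewrite size_encode_input.
- exact: leq_addr.
- exact: leq_addl.
by rewrite -outE memE (eq_map (fun i => memE i.+1)).
Qed.
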